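(* Let $\underline{t}>0$ be fixed and let $y^0\in\mathbb{R}^m$ be an initial point of the fast gradient decomposition algorithm (described in the context) such that $\|\nabla g(y^0;\underline{t})\|_2\le\frac{3\bar{c}_A}{4}$. Then the sequence $\{(y^k,v^k)\}_{k\ge0}$ generated by this algorithm satisfies $$g(y^k;\underline{t})-g^*(\underline{t})\le\frac{4\bar{c}_A^2}{\underline{t}(k+1)^2}\|y^0-y^*(\underline{t})\|_2^2.$$
   Context: Problem data: $m,N\ge 1$; for $i=1,\dots,N$, $\phi_i:\mathbb{R}^{n_i}\to\mathbb{R}$ is concave, $X_i\subset\mathbb{R}^{n_i}$ is a nonempty closed convex set, $A_i\in\mathbb{R}^{m\times n_i}$, $b_i\in\mathbb{R}^m$; $n=\sum_i n_i$, $A=[A_1,\dots,A_N]$, $b=\sum_i b_i$, $X=X_1\times\cdots\times X_N$, $\phi(x)=\sum_i\phi_i(x_i)$. The separable convex problem is $\phi^*=\max\{\phi(x): Ax=b,\ x\in X\}$. Standing assumptions. (A1) The solution set of this problem is nonempty; either $X$ is polyhedral or $\mathrm{ri}(X)\cap\{x: Ax=b\}\ne\emptyset$; the $\phi_i$ are proper, upper semicontinuous and concave; $A$ has full row rank. (A2) Each $X_i$ is bounded and is endowed with a self-concordant barrier $F_i$ (defined on $\mathrm{int}(X_i)\neq\emptyset$) with parameter $\nu_i>0$. It is also taken as standing that for every $t>0$ the smoothed dual problem $g^*(t):=\min_{y\in\mathbb{R}^m} g(y;t)$ has a unique solution $y^*(t)$. Notation: $x_i^c=\arg\min_{\mathrm{int}(X_i)}F_i$,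 $x^c=(x_1^c,\dots,x_N^c)$, and $F_i$ is normalized so that $F_i(x_i^c)=0$; $F(x)=\sum_iF_i(x_i)$. For $t>0$, $g(y;t)=\max_{x\in\mathrm{int}(X)}\{\phi(x)+y^T(Ax-b)-tF(x)\}$, whose unique maximizer is $x^*(y;t)$; $g(\cdot;t)$ is smooth and $\nabla g(y;t)=Ax^*(y;t)-b$ (gradient in $y$). For $x\in\mathrm{int}(X)$, $|\!|\!|A|\!|\!|_x^*:=\|A\nabla^2F(x)^{-1}A^T\|_2^{1/2}$. $\bar{c}_A:=\kappa|\!|\!|A|\!|\!|_{x^c}^*$ with $\kappa:=\sum_{i=1}^N[\nu_i+2\sqrt{\nu_i}]$. Algorithm. Set $\theta_0=1$, $v^0=y^0$. For $k=0,1,\dots$: let $\lambda_k=\|\nabla g(v^k;\underline{t})\|_2$ and $r^k=\theta_k^{-1}[v^k-(1-\theta_k)y^k]$; $y^{k+1}=v^k-\alpha_k\nabla g(v^k;\underline{t})$ with $\alpha_k=\dfrac{\underline{t}}{\bar{c}_A(\bar{c}_A+\lambda_k)}$; $\theta_{k+1}=\frac12\theta_k\big[(\theta_k^2+4)^{1/2}-\theta_k\big]$; $v^{k+1}=(1-\theta_{k+1})y^{k+1}+\theta_{k+1}\big(r^k-\rho_k\nabla g(v^k;\underline{t})\big)$ with $\rho_k=\dfrac{\underline{t}}{2\bar{c}_A^2\theta_k}$. (The stopping test $\lambda_k\le\varepsilon$ is disregarded when considering the infinite sequence.) *)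

(* Defs.v *)
From HB Require Import structures.
From mathcomp Require Import all_boot all_order all_algebra.
From mathcomp Require Import all_classical all_reals all_analysis.

Set Implicit Arguments.
Unset Strict Implicit.
Unset Printing Implicit Defensive.

Import Order.TTheory GRing.Theory Num.Theory.
Import numFieldNormedType.Exports.

Local Open Scope classical_set_scope.
Local Open Scope ring_scope.

(* MathComp-Analysis norms 'cV[R]_n by the sup norm; the Euclidean norm and the
   spectral norm are therefore defined here.  The induced topology, hence
   interiors, continuity and directional derivatives, is the same. *)

Definition dotv (R : realType) n (u v : 'cV[R]_n) : R := (u^T *m v) 0 0.

Definition norm2 (R : realType) n (u : 'cV[R]_n) : R := Num.sqrt (dotv u u).

Definition spectral_norm (R : realType) m n (M : 'M[R]_(m, n)) : R :=
  sup [set norm2 (M *m u) | u in [set u : 'cV[R]_n | norm2 u <= 1]].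

Definition grad (R : realType) n (f : 'cV[R]_n -> R) (x : 'cV[R]_n) : 'cV[R]_n :=
  \col_i 'D_(delta_mx i 0) f x.

Definition hessian (R : realType) n (f : 'cV[R]_n -> R) (x : 'cV[R]_n) : 'M[R]_n :=
  \matrix_(i, j) 'D_(delta_mx j 0) ('D_(delta_mx i 0) f) x.

(* f is of class C^k on the open set D. *)
Fixpoint class_C (R : realType) n (k : nat) (D : set 'cV[R]_n)
    (f : 'cV[R]_n -> R) : Prop :=
  (forall x, D x -> {for x, continuous f}) /\
  if k is j.+1 then
    forall u, (forall x, D x -> derivable f x u) /\ class_C j D ('D_u f)
  else True.

Definition concave_function (R : realType) n (f : 'cV[R]_n -> R) : Prop :=
  convex_function [set: convex_lmodType 'cV[R]_n] (fun x => - f x).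

Definition proper_concave (R : realType) (T : Type) (f : T -> \bar R) : Prop :=
  (exists x, f x != -oo%E) /\ (forall x, f x != +oo%E).

Definition upper_semicontinuous (R : realType) (T : topologicalType)
    (f : T -> \bar R) : Prop :=
  lower_semicontinuous (fun x => - f x)%E.

Definition polyhedral (R : realType) n (C : set 'cV[R]_n) : Prop :=
  exists p (M : 'M[R]_(p, n)) (d : 'cV[R]_p),
    C = [set x | forall i, (M *m x) i 0 <= d i 0].

Definition affine_hull (R : realType) n (C : set 'cV[R]_n) : set 'cV[R]_n :=
  [set z | exists p (a : 'I_p -> R) (c : 'I_p -> 'cV[R]_n),
    [/\ forall j, C (c j), \sum_j a j = 1 & z = \sum_j a j *: c j]].

Definition relint (R : realType) n (C : set 'cV[R]_n) : set 'cV[R]_n :=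
  [set x | C x /\ \forall z \near x, affine_hull C z -> C z].

Definition is_argmin (R : realType) (T : Type) (D : set T) (f : T -> R) (x : T)
  : Prop := D x /\ forall z, D z -> f x <= f z.

Definition is_argmax (R : realType) (T : Type) (D : set T) (f : T -> R) (x : T)
  : Prop := D x /\ forall z, D z -> f z <= f x.

Record self_concordant (R : realType) n (D : set 'cV[R]_n)
    (F : 'cV[R]_n -> R) : Prop := {
  sc_C3 : class_C 3 D F ;
  sc_convex : convex_function (D : set (convex_lmodType 'cV[R]_n)) F ;
  sc_third : forall x u, D x ->
    `|'D_u ('D_u ('D_u F)) x| <= 2 * dotv u (hessian F x *m u) `^ (3 / 2) }.

(* F is a total function, but only its values on the interior of X matter. *)
Record self_concordant_barrier (R : realType) n (X : set 'cV[R]_n) (nu : R)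
    (F : 'cV[R]_n -> R) : Prop := {
  scb_sc : self_concordant X° F ;
  scb_boundary : forall x, (closure X° `\` X°) x ->
    F z @[z --> within X° (nbhs x)] --> +oo ;
  scb_parameter : forall x u, X° x ->
    2 * dotv (grad F x) u - dotv u (hessian F x *m u) <= nu }.

(* R^n, n = \sum_i n_i, is 'cV[R]_(\sum_i n i); submxcol x i is the block x_i. *)

Definition prod_set (R : realType) N (n : 'I_N -> nat)
    (X : forall i, set 'cV[R]_(n i)) : set 'cV[R]_(\sum_i n i) :=
  [set x | forall i, X i (submxcol x i)].

Definition sep_sum (R : realType) N (n : 'I_N -> nat)
    (f : forall i, 'cV[R]_(n i) -> R) (x : 'cV[R]_(\sum_i n i)) : R :=
  \sum_i f i (submxcol x i).

(* The maximum over int X, written as a supremum. *)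
Definition smoothed_dual (R : realType) m n (phi F : 'cV[R]_n -> R)
    (X : set 'cV[R]_n) (A : 'M[R]_(m, n)) (b : 'cV[R]_m) (t : R)
    (y : 'cV[R]_m) : R :=
  sup [set phi x + dotv y (A *m x - b) - t * F x | x in X°].

(* The minimum over y, written as an infimum. *)
Definition smoothed_dual_value (R : realType) m n (phi F : 'cV[R]_n -> R)
    (X : set 'cV[R]_n) (A : 'M[R]_(m, n)) (b : 'cV[R]_m) (t : R) : R :=
  inf (range (smoothed_dual phi F X A b t)).

Definition local_norm (R : realType) m n (F : 'cV[R]_n -> R)
    (A : 'M[R]_(m, n)) (x : 'cV[R]_n) : R :=
  Num.sqrt (spectral_norm (A *m invmx (hessian F x) *m A^T)).

Definition kappa (R : realType) N (nu : 'I_N -> R) : R :=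
  \sum_i (nu i + 2 * Num.sqrt (nu i)).

(* The infinite run of the fast gradient method for an objective with gradient
   G, smoothness parameter t and constant c, started at y 0. *)
Record fast_gradient_run (R : realType) m (G : 'cV[R]_m -> 'cV[R]_m) (t c : R)
    (y v : nat -> 'cV[R]_m) (theta : nat -> R) : Prop := {
  fg_theta0 : theta 0%N = 1 ;
  fg_v0 : v 0%N = y 0%N ;
  fg_y : forall k,
    let lambda := norm2 (G (v k)) in
    let alpha := t / (c * (c + lambda)) in
    y k.+1 = v k - alpha *: G (v k) ;
  fg_theta : forall k,
    theta k.+1 = 2^-1 * theta k * (Num.sqrt (theta k ^+ 2 + 4) - theta k) ;
  fg_v : forall k,
    let r := (theta k)^-1 *: (v k - (1 - theta k) *: y k) in
    let rho := t / (2 * c ^+ 2 * theta k) in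
    v k.+1 = (1 - theta k.+1) *: y k.+1
             + theta k.+1 *: (r - rho *: G (v k)) }.

(* Main.v *)
(** The proof uses a uniform smoothness constant of the dual instead of the
    local one. Along a ray issued from its minimizer x^c, the restriction of the
    barrier F_i satisfies one-dimensional differential inequalities which show
    that X_i lies in the local ball of radius nu_i + 2 sqrt(nu_i) at x_i^c,
    while at every interior point the open unit Dikin ball stays in X_i.
    Comparing the two ellipsoids gives
    D^2 F_i(x) >= D^2 F_i(x_i^c) / (nu_i + 2 sqrt(nu_i))^2, so that F is
    1-strongly convex for the norm N = |.|_{x^c} / kappa, with respect to which
    X has diameter at most 2 and A is cbar_A-Lipschitz. Hence g(.; t) is
    convex with a gradient of norm at most 2 cbar_A, and it lies below its
    tangents plus cbar_A^2 / (2 t) |.|^2. As lambda_k <= 2 cbar_A, the step alpha_k decreases g by at least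
    t lambda_k^2 / (4 cbar_A^2), and the usual potential argument for
    accelerated gradient methods applies. *)
Require Import Defs.
From mathcomp Require Import all_boot all_order all_algebra.
From mathcomp Require Import all_classical all_reals all_analysis.
From mathcomp Require Import ring lra.
Import Order.TTheory GRing.Theory Num.Theory.
Import numFieldNormedType.Exports.
Local Open Scope classical_set_scope.
Local Open Scope ring_scope.

Set Implicit Arguments.
Unset Strict Implicit.
Unset Printing Implicit Defensive.

(** * Euclidean and spectral norms *)

(** [smoothed_dual] is a supremum over an open set, and no maximizer of the Lagrangian is ever
    produced. What is known about g comes from near-maximizers: strong convexity makes the values of
    A x at two e-maximizers agree up to O(sqrt e), the common limit of A x - b is a candidate
    gradient, and differentiability follows last, from the affine lower bound and the quadratic
    upper bound that this candidate satisfies. The bound 2 cbar_A on the gradient comes from a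
    feasible point xh: since b = A xh, A x - b = A (x - xh), and X has diameter at most 2. The step
    rho_k is the one for which the squared-gradient term in the expansion of |r^{k+1} - y^*|^2
    matches exactly the guaranteed decrease t lambda_k^2 / (4 cbar_A^2). *)

Lemma dotvE (R : realType) n (u v : 'cV[R]_n) :
  dotv u v = \sum_i u i 0 * v i 0.
Proof. by rewrite /dotv mxE; apply: eq_bigr => i _; rewrite mxE. Qed.

Lemma dotvC (R : realType) n (u v : 'cV[R]_n) : dotv u v = dotv v u.
Proof. by rewrite !dotvE; apply: eq_bigr => i _; rewrite mulrC. Qed.

Lemma dotvDl (R : realType) n (u v w : 'cV[R]_n) :
  dotv (u + v) w = dotv u w + dotv v w.
Proof. by rewrite /dotv linearD mulmxDl mxE. Qed.

Lemma dotvZl (R : realType) n a (u v : 'cV[R]_n) :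
  dotv (a *: u) v = a * dotv u v.
Proof. by rewrite /dotv linearZ -scalemxAl mxE. Qed.

Lemma dotvDr (R : realType) n (u v w : 'cV[R]_n) :
  dotv u (v + w) = dotv u v + dotv u w.
Proof. by rewrite dotvC dotvDl !(dotvC u). Qed.

Lemma dotvZr (R : realType) n a (u v : 'cV[R]_n) :
  dotv u (a *: v) = a * dotv u v.
Proof. by rewrite dotvC dotvZl dotvC. Qed.

Lemma dotvNl (R : realType) n (u v : 'cV[R]_n) : dotv (- u) v = - dotv u v.
Proof. by rewrite -scaleN1r dotvZl mulN1r. Qed.

Lemma dotvNr (R : realType) n (u v : 'cV[R]_n) : dotv u (- v) = - dotv u v.
Proof. by rewrite dotvC dotvNl dotvC. Qed.

Lemma dotv0l (R : realType) n (u : 'cV[R]_n) : dotv 0 u = 0.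
Proof. by rewrite -(scale0r 0) dotvZl mul0r. Qed.

Lemma dotv0r (R : realType) n (u : 'cV[R]_n) : dotv u 0 = 0.
Proof. by rewrite dotvC dotv0l. Qed.

Lemma dotv_ge0 (R : realType) n (u : 'cV[R]_n) : 0 <= dotv u u.
Proof.
by rewrite dotvE sumr_ge0// => i _; rewrite -expr2 sqr_ge0.
Qed.

Lemma dotv_eq0 (R : realType) n (u : 'cV[R]_n) : dotv u u = 0 -> u = 0.
Proof.
rewrite dotvE => /eqP; rewrite psumr_eq0 => [/allP u0|i _]; last first.
  by rewrite -expr2 sqr_ge0.
apply/colP => i; have := u0 i (mem_index_enum _).
by rewrite /= mulf_eq0 orbb mxE => /eqP.
Qed.

Lemma dotv_mulmxr (R : realType) m n (M : 'M[R]_(m, n)) u v :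
  dotv u (M *m v) = dotv (M^T *m u) v.
Proof. by rewrite /dotv trmx_mul trmxK mulmxA. Qed.

Lemma norm2_ge0 (R : realType) n (u : 'cV[R]_n) : 0 <= norm2 u.
Proof. exact: sqrtr_ge0. Qed.

Lemma norm2_sqr (R : realType) n (u : 'cV[R]_n) : norm2 u ^+ 2 = dotv u u.
Proof. by rewrite sqr_sqrtr// dotv_ge0. Qed.

Lemma norm2Z (R : realType) n a (u : 'cV[R]_n) :
  norm2 (a *: u) = `|a| * norm2 u.
Proof.
by rewrite /norm2 dotvZl dotvZr mulrA -expr2 sqrtrM ?sqr_ge0// sqrtr_sqr.
Qed.

Lemma norm2N (R : realType) n (u : 'cV[R]_n) : norm2 (- u) = norm2 u.
Proof. by rewrite -scaleN1r norm2Z normrN1 mul1r. Qed.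

Lemma norm2_subZ_sqr (R : realType) n (u v : 'cV[R]_n) a :
  norm2 (u - a *: v) ^+ 2 =
  norm2 u ^+ 2 - 2 * a * dotv v u + a ^+ 2 * norm2 v ^+ 2.
Proof.
rewrite !norm2_sqr !(dotvDl, dotvDr, dotvNl, dotvNr, dotvZl, dotvZr).
by rewrite (dotvC u v); ring.
Qed.

Lemma norm2_gt0 (R : realType) n (u : 'cV[R]_n) : u != 0 -> 0 < norm2 u.
Proof.
move=> u0; rewrite sqrtr_gt0 lt0r dotv_ge0 andbT.
by apply: contra u0 => /eqP/dotv_eq0 ->.
Qed.

Lemma cauchy_schwarz (R : realType) n (H : 'M[R]_n) (u v : 'cV[R]_n) :
  H^T = H -> (forall w, 0 <= dotv w (H *m w)) ->
  dotv u (H *m v) ^+ 2 <= dotv u (H *m u) * dotv v (H *m v).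
Proof.
move=> symH psdH.
have uv : dotv v (H *m u) = dotv u (H *m v).
  by rewrite dotv_mulmxr symH dotvC.
have pol s : 0 <= dotv u (H *m u) + 2 * s * dotv u (H *m v)
                  + s ^+ 2 * dotv v (H *m v).
  have := psdH (u + s *: v).
  rewrite mulmxDr -scalemxAr !dotvDl !dotvDr !dotvZl !dotvZr uv.
  by congr (_ <= _); ring.
have := psdH v; rewrite le_eqVlt => /predU1P[v0|v_gt0]; last first.
  have := pol (- dotv u (H *m v) / dotv v (H *m v)).
  move=> /(mulr_ge0 (ltW v_gt0)); rewrite -[in X in _ -> X]subr_ge0.
  congr (_ <= _); field.
  by rewrite gt_eqF.
rewrite -v0 mulr0; have [->|uv0] := eqVneq (dotv u (H *m v)) 0.
  by rewrite expr0n.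
(* With [v] isotropic the polynomial is affine in s; at this s it equals -1. *)
have := pol (- (dotv u (H *m u) + 1) / (2 * dotv u (H *m v))).
rewrite -v0 mulr0 addr0.
have E x y : y != 0 -> 2 * (x / (2 * y)) * y = x :> R by move=> y0; field.
by rewrite E// opprD addrA subrr add0r ler0N1.
Qed.

Lemma dotv_le_norm2 (R : realType) n (u v : 'cV[R]_n) :
  dotv u v <= norm2 u * norm2 v.
Proof.
have psd1 (w : 'cV[R]_n) : 0 <= dotv w (1%:M *m w) by rewrite mul1mx dotv_ge0.
have := @cauchy_schwarz _ _ 1%:M u v (trmx1 _ _) psd1; rewrite !mul1mx => cs.
apply: le_trans (ler_norm _) _.
rewrite -ler_sqr ?nnegrE ?mulr_ge0 ?norm2_ge0//.
by rewrite exprMn !norm2_sqr real_normK// num_real.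
Qed.

Lemma norm2D (R : realType) n (u v : 'cV[R]_n) :
  norm2 (u + v) <= norm2 u + norm2 v.
Proof.
rewrite -ler_sqr ?nnegrE ?addr_ge0 ?norm2_ge0//.
rewrite norm2_sqr dotvDl !dotvDr sqrrD !norm2_sqr (dotvC v u).
by have := dotv_le_norm2 u v; lra.
Qed.

Lemma ler_dotv_spectral_norm (R : realType) n (M : 'M[R]_n) (u : 'cV[R]_n) :
  dotv u (M *m u) <= spectral_norm M * dotv u u.
Proof.
have [->|u0] := eqVneq u 0; first by rewrite !dotv0l mulr0.
have nu0 := norm2_gt0 u0.
pose S := [set norm2 (M *m w) | w in [set w : 'cV[R]_n | norm2 w <= 1]].
(* A supremum dominates the values only once the set is known to be bounded; entries of a vector of
   the unit ball are at most 1, so absolute row sums bound [M *m w]. *)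
have bndS : has_ubound S.
  pose a := Num.sqrt (\sum_i (\sum_j `|M i j|) ^+ 2).
  exists a => _ [w /= w1 <-]; rewrite /norm2 /a ler_wsqrtr// dotvE.
  apply: ler_sum => i _; rewrite -expr2 -real_normK ?num_real//.
  have Mw : `|(M *m w) i 0| <= \sum_j `|M i j|.
    rewrite mxE; apply: le_trans (ler_norm_sum _ _ _) _.
    apply: ler_sum => j _; rewrite normrM ler_piMr//.
    rewrite -(@ler_pXn2r _ 2)// ?nnegrE// real_normK ?num_real// expr1n.
    have : dotv w w <= 1 by rewrite -norm2_sqr exprn_ile1 ?norm2_ge0.
    rewrite dotvE (bigD1 j)//= -expr2; apply: le_trans; rewrite lerDl.
    by rewrite sumr_ge0// => k _; rewrite -expr2 sqr_ge0.
  by rewrite ler_sqr ?nnegrE// sumr_ge0.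
pose w := (norm2 u)^-1 *: u.
have nw : norm2 w = 1.
  by rewrite norm2Z ger0_norm ?invr_ge0 ?norm2_ge0// mulVf// gt_eqF.
have : norm2 (M *m w) <= spectral_norm M.
  by apply: ub_le_sup => //; exists w => //=; rewrite nw.
rewrite -scalemxAr norm2Z ger0_norm ?invr_ge0 ?norm2_ge0//.
rewrite ler_pdivrMl// => Mu; apply: le_trans (dotv_le_norm2 _ _) _.
by rewrite -norm2_sqr expr2; have := norm2_ge0 u; nra.
Qed.

Lemma spectral_norm_ge0 (R : realType) m n (M : 'M[R]_(m, n)) :
  0 <= spectral_norm M.
Proof.
rewrite /spectral_norm; set S := (X in sup X).
(* Without a supremum, [sup] takes its default value 0. *)
have [supS|/sup_out ->//] := pselect (has_sup S).
apply: (ub_le_sup supS.2).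
by exists 0; rewrite /= ?mulmx0 /norm2 dotv0l sqrtr0.
Qed.

Lemma quad_invmx_gt0 (R : realType) n (H : 'M[R]_n) (p : 'cV[R]_n) :
  H^T = H -> (forall w, w != 0 -> 0 < dotv w (H *m w)) -> p != 0 ->
  H \in unitmx /\ 0 < dotv p (invmx H *m p).
Proof.
move=> symH pdH p0.
have uH : H \in unitmx.
  rewrite -row_free_unit -kermx_eq0; apply/eqP/row_matrixP => i.
  rewrite row0; set r := row i _.
  have rH : r *m H = 0 by rewrite /r -row_mul mulmx_ker row0.
  apply/eqP; apply: contraT => r0.
  have := pdH r^T; rewrite -trmx_eq0 trmxK => /(_ r0).
  by rewrite -symH -trmx_mul rH trmx0 dotv0r ltxx.
split => //; set q := invmx H *m p.
have pE : p = H *m q by rewrite mulKVmx.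
rewrite {1}pE dotvC pdH//.
by apply: contra p0 => /eqP q0; rewrite pE q0 mulmx0.
Qed.

(** * One-dimensional self-concordance *)

Section one_dimensional.
Variable R : realType.
Implicit Types (f df p q : R -> R) (a b c s e : R).

Lemma MVT_cc f df a b : a < b ->
  (forall s, a <= s <= b -> is_derive s 1 f (df s)) ->
  exists2 c, a < c < b & f b - f a = df c * (b - a).
Proof.
move=> ab dfE; have [s||c + fab] := @MVT _ f df a b ab.
- by rewrite in_itv/= => /andP[as_ sb]; apply: dfE; rewrite !ltW.
- by apply: derivable_within_continuous => s; rewrite in_itv/= => /dfE[].
- by rewrite in_itv/= => cab; exists c.
Qed.

Lemma le_of_derive_le f df a b c : a <= b ->
  (forall s, a <= s <= b -> is_derive s 1 f (df s)) ->
  (forall s, a <= s <= b -> df s <= c) -> f b - f a <= c * (b - a).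
Proof.
rewrite le_eqVlt => /predU1P[->|ab] dfE dfc; first by rewrite !subrr mulr0.
have [s /andP[as_ sb] ->] := MVT_cc ab dfE.
by rewrite ler_pM2r ?subr_gt0// dfc// !ltW.
Qed.

Lemma ge_of_derive_ge f df a b c : a <= b ->
  (forall s, a <= s <= b -> is_derive s 1 f (df s)) ->
  (forall s, a <= s <= b -> c <= df s) -> c * (b - a) <= f b - f a.
Proof.
rewrite le_eqVlt => /predU1P[->|ab] dfE dfc; first by rewrite !subrr mulr0.
have [s /andP[as_ sb] ->] := MVT_cc ab dfE.
by rewrite ler_pM2r ?subr_gt0// dfc// !ltW.
Qed.

(* The regularization [e] avoids the zeros of [p]: without it the statement
   says that [p^(-1/2)] is 1-Lipschitz. *)
Lemma self_concordant_isqrt_lip p q a e : 0 < e -> 0 <= a ->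
  (forall s, 0 <= s <= a -> is_derive s 1 p (q s)) ->
  (forall s, 0 <= s <= a -> 0 <= p s) ->
  (forall s, 0 <= s <= a -> `|q s| <= 2 * p s `^ (3 / 2)) ->
  `|(Num.sqrt (p a + e))^-1 - (Num.sqrt (p 0 + e))^-1| <= a.
Proof.
move=> e0 a0 dp p0 qp.
pose w s := (p s + e) `^ (- 2^-1).
have wE s : 0 <= s <= a -> w s = (Num.sqrt (p s + e))^-1.
  by move=> sa; rewrite /w powRN powR12_sqrt// addr_ge0 ?p0// ltW.
pose dw s := - 2^-1 * (p s + e) `^ (- 2^-1 - 1) * q s.
have pe s : 0 <= s <= a -> 0 < p s + e.
  by move=> sa; rewrite ltr_wpDl// p0.
have dwE s : 0 <= s <= a -> is_derive s 1 w (dw s).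
  move=> sa; have dps := dp s sa.
  have dpe : is_derive s 1 (fun s => p s + e) (q s).
    rewrite -[q s]addr0; apply: is_deriveD.
  exact: (@is_derive1_comp _ (@powR R ^~ (- 2^-1)) (fun s => p s + e) s _ _
    (is_derive1_powR (- 2^-1) (pe s sa)) dpe).
have dw1 s : 0 <= s <= a -> `|dw s| <= 1.
  move=> sa; rewrite /dw !normrM normrN (ger0_norm (powR_ge0 _ _)).
  rewrite (@ger0_norm _ 2^-1) ?invr_ge0// -opprD powRN.
  have -> : 2^-1 + 1 = 3 / 2 :> R by field.
  have := qp s sa; have : p s `^ (3 / 2) <= (p s + e) `^ (3 / 2).
    apply: ge0_ler_powR => //; rewrite ?nnegrE ?p0 ?(ltW (pe _ _))//.
    by rewrite lerDl ltW.
  have := powR_gt0 (3 / 2) (pe s sa); set y := _ `^ _; set x := p s `^ _.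
  move=> y0 xy qx; rewrite mulrAC ler_pdivrMr//; lra.
have a0a : 0 <= a <= a by apply/andP.
have a00 : 0 <= (0 : R) <= a by rewrite lexx.
rewrite -!wE// ler_norml; apply/andP; split.
- have := ge_of_derive_ge a0 dwE (c := -1); rewrite subr0 mulN1r; apply.
  by move=> s /dw1; rewrite ler_norml => /andP[].
- have := le_of_derive_le a0 dwE (c := 1); rewrite subr0 mul1r; apply.
  by move=> s /dw1; rewrite ler_norml => /andP[].
Qed.

(** Keeps the second derivative finite on a segment that is short in the local norm; [dikin] rests
    on it. *)
Lemma self_concordant_upper p q a b : 0 <= a -> 0 <= b -> p 0 < b ^+ 2 ->
  a * b < 1 ->
  (forall s, 0 <= s <= a -> is_derive s 1 p (q s)) ->
  (forall s, 0 <= s <= a -> 0 <= p s) ->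
  (forall s, 0 <= s <= a -> `|q s| <= 2 * p s `^ (3 / 2)) ->
  p a <= (b / (1 - a * b)) ^+ 2.
Proof.
move=> a0 b0 pb ab dp p0 qp.
have pa0 : 0 <= p a by rewrite p0// a0 lexx.
have p00 : 0 <= p 0 by rewrite p0// a0 lexx.
have b_gt0 : 0 < b by rewrite lt0r b0 andbT; apply: contraTneq pb => ->;
  rewrite expr0n/= -leNgt.
(* This regularization makes [Num.sqrt (p 0 + e)] equal to [b]. *)
have e0 : 0 < b ^+ 2 - p 0 by rewrite subr_gt0.
have := self_concordant_isqrt_lip e0 a0 dp p0 qp.
rewrite subrKC sqrtr_sqr (ger0_norm b0) ler_distl => /andP[+ _].
set y := Num.sqrt _ => yb.
have y0 : 0 < y by rewrite sqrtr_gt0 ltr_wpDl.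
apply: (@le_trans _ _ (y ^+ 2)); first by rewrite /y sqr_sqrtr ?lerDl ?(addr_ge0 pa0 (ltW e0)) ?ltW.
rewrite ler_sqr ?nnegrE ?divr_ge0 ?subr_ge0 ?(ltW y0) ?(ltW ab)//.
rewrite ler_pdivlMr ?subr_gt0//.
have : (b^-1 - a) * (b * y) <= y^-1 * (b * y) by rewrite ler_pM2r// mulr_gt0.
have -> : (b^-1 - a) * (b * y) = y * (1 - a * b) by field; rewrite gt_eqF.
by have -> : y^-1 * (b * y) = b by field; rewrite gt_eqF.
Qed.

Lemma self_concordant_lower p q a : 0 <= a ->
  (forall s, 0 <= s <= a -> is_derive s 1 p (q s)) ->
  (forall s, 0 <= s <= a -> 0 <= p s) ->
  (forall s, 0 <= s <= a -> `|q s| <= 2 * p s `^ (3 / 2)) ->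
  (Num.sqrt (p 0) / (1 + Num.sqrt (p 0) * a)) ^+ 2 <= p a.
Proof.
move=> a0 dp p0 qp; apply/ler_addgt0Pr => e e0.
have pa0 : 0 <= p a by rewrite p0// a0 lexx.
have p00 : 0 <= p 0 by rewrite p0// a0 lexx.
have := self_concordant_isqrt_lip e0 a0 dp p0 qp.
rewrite ler_distl => /andP[_].
have : Num.sqrt (p 0) <= Num.sqrt (p 0 + e) by rewrite ler_wsqrtr// lerDl ltW.
have := sqrtr_ge0 (p 0).
have : 0 < Num.sqrt (p 0 + e) by rewrite sqrtr_gt0 ltr_wpDl.
have : 0 < Num.sqrt (p a + e) by rewrite sqrtr_gt0 ltr_wpDl.
set y := Num.sqrt (p a + e); set z := Num.sqrt (p 0 + e).
set x := Num.sqrt (p 0) => y0 z0 x0 xz yz.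
have -> : p a + e = y ^+ 2 by rewrite /y sqr_sqrtr// addr_ge0// ltW.
have xa : 0 < 1 + x * a by rewrite ltr_pwDl// mulr_ge0.
rewrite ler_sqr ?nnegrE ?(ltW y0) ?divr_ge0 ?(ltW xa)//.
rewrite ler_pdivrMr//.
have : y^-1 * (y * z) <= (z^-1 + a) * (y * z).
  by rewrite ler_pM2r// mulr_gt0.
have -> : y^-1 * (y * z) = z by field; rewrite gt_eqF.
have -> : (z^-1 + a) * (y * z) = y + a * (y * z) by field; rewrite gt_eqF.
(* The goal is x (1 - a y) <= y: trivial if a y >= 1, otherwise implied by z (1 - a y) <= y and x <=
   z. *)
move=> zy; have [ay|ay] := leP 1 (a * y).
  by have := ler_wpM2l x0 ay; have := ltW y0; lra.
have : x * (1 - a * y) <= z * (1 - a * y) by rewrite ler_pM2r// subr_gt0.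
by lra.
Qed.

Lemma strong_convexity_1d f f1 f2 c l : 0 <= l <= 1 ->
  (forall s, 0 <= s <= 1 -> is_derive s 1 f (f1 s)) ->
  (forall s, 0 <= s <= 1 -> is_derive s 1 f1 (f2 s)) ->
  (forall s, 0 <= s <= 1 -> c <= f2 s) ->
  f l <= (1 - l) * f 0 + l * f 1 - l * (1 - l) * c / 2.
Proof.
move=> /andP[]; rewrite le_eqVlt => /predU1P[<-|l0]; first by lra.
rewrite le_eqVlt => /predU1P[->|l1]; first by lra.
move=> df df1 f2c.
(* Subtracting the parabola leaves a function with nondecreasing derivative; the slopes of its
   chords on both sides of [l] are then compared. *)
pose h s := f s - c / 2 * s ^+ 2; pose h1 s := f1 s - c * s.
have dh s : 0 <= s <= 1 -> is_derive s 1 h (h1 s).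
  move=> s01; have ds := df s s01; rewrite /h.
  by apply: is_derive_eq; rewrite /h1 /GRing.scale/=; field.
have [x /andP[x0 xl] hx] : exists2 x, 0 < x < l & h l - h 0 = h1 x * (l - 0).
  by apply: MVT_cc => // s /andP[s0 sl]; apply: dh; rewrite s0 (le_trans sl)// ltW.
have [z /andP[lz z1] hz] : exists2 x, l < x < 1 & h 1 - h l = h1 x * (1 - l).
  by apply: MVT_cc => // s /andP[s0 sl]; apply: dh; rewrite sl (le_trans _ s0)// ltW.
have xz : x <= z by rewrite ltW// (lt_trans xl).
have : c * (z - x) <= f1 z - f1 x.
  apply: ge_of_derive_ge xz _ _ => s /andP[xs sz].
  - by apply: df1; rewrite (le_trans (ltW x0))//= (le_trans sz)// ltW.
  - by apply: f2c; rewrite (le_trans (ltW x0))//= (le_trans sz)// ltW.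
move=> f1xz; have h1xz : h1 x <= h1 z by rewrite /h1; lra.
have : (h l - h 0) * (1 - l) <= (h 1 - h l) * l.
  rewrite hx hz subr0; have : 0 < l * (1 - l) by rewrite mulr_gt0// subr_gt0.
  by nra.
rewrite /h; nra.
Qed.

(** Crude on purpose: what matters is a bound independent of [a], which excludes a blow-up along a
    segment. *)
Lemma upper_bound_1d f f1 f2 c : forall a, 0 <= a <= 1 -> 0 <= c ->
  (forall s, 0 <= s <= a -> is_derive s 1 f (f1 s)) ->
  (forall s, 0 <= s <= a -> is_derive s 1 f1 (f2 s)) ->
  (forall s, 0 <= s <= a -> f2 s <= c) ->
  f a <= f 0 + `|f1 0| + c.
Proof.
move=> a /andP[a0 a1] c0 df df1 f2c.
have f1c s : 0 <= s <= a -> f1 s <= `|f1 0| + c.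
  move=> /andP[s0 sa]; have : f1 s - f1 0 <= c * (s - 0).
    apply: le_of_derive_le s0 _ _ => u /andP[u0 us].
    - by apply: df1; rewrite u0 (le_trans us).
    - by apply: f2c; rewrite u0 (le_trans us).
  have := ler_norm (f1 0); have : c * s <= c by rewrite ler_piMr// (le_trans sa).
  by lra.
have := le_of_derive_le a0 df f1c; rewrite subr0.
have : (`|f1 0| + c) * a <= `|f1 0| + c by rewrite ler_piMr// addr_ge0.
by lra.
Qed.

(* Nesterov's estimate of the domain of a barrier with parameter [nu] along a
   ray issued from its minimizer; [g] is the derivative of the barrier. *)
Lemma barrier_radius_1d g p q nu : 0 < nu ->
  (forall s, 0 <= s <= 1 -> is_derive s 1 g (p s)) ->
  (forall s, 0 <= s <= 1 -> is_derive s 1 p (q s)) ->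
  (forall s, 0 <= s <= 1 -> 0 <= p s) ->
  (forall s, 0 <= s <= 1 -> `|q s| <= 2 * p s `^ (3 / 2)) ->
  (forall s, 0 <= s <= 1 -> g s ^+ 2 <= nu * p s) ->
  g 0 = 0 ->
  p 0 <= (nu + 2 * Num.sqrt nu) ^+ 2.
Proof.
move=> nu0 dg dp p_ge0 qp gp g0.
have p00 : 0 <= p 0 by rewrite p_ge0// lexx ler01.
rewrite -[p 0]sqr_sqrtr//; set r := Num.sqrt (p 0).
have := sqrtr_gt0 nu; rewrite nu0; set w := Num.sqrt nu => w0.
have nuE : nu = w ^+ 2 by rewrite sqr_sqrtr// ltW.
have r0 : 0 <= r by exact: sqrtr_ge0.
rewrite ler_sqr ?nnegrE ?addr_ge0 ?mulr_ge0 ?(ltW nu0) ?(ltW w0)//.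
have [rw|wr] := leP r w; first by lra.
have r_gt0 : 0 < r by apply: lt_trans wr.
(* The segment is cut where the local length r s reaches sqrt(nu): self-concordance makes [g] grow
   before [al], the barrier parameter limits what can follow. *)
pose al := w / r.
have al0 : 0 < al by rewrite divr_gt0.
have al1 : al < 1 by rewrite ltr_pdivrMr// mul1r.
have alr : al * r = w by rewrite divfK// gt_eqF.
have in01 s : 0 <= s <= al -> 0 <= s <= 1.
  by move=> /andP[-> sal]; rewrite (le_trans sal)// ltW.
have rs s : 0 <= s -> 0 < 1 + r * s by move=> s0; rewrite ltr_pwDl// mulr_ge0.
(* [g] minus a primitive of the lower bound (r / (1 + r s))^2 of [p]; its monotonicity gives g(al)
   >= r w / (1 + w). *)
pose h s := g s + r * (1 + r * s)^-1.
have dh s : 0 <= s <= al ->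
    is_derive s 1 h (p s - (r / (1 + r * s)) ^+ 2).
  move=> sal; have ds := dg s (in01 _ sal).
  have rs0 : 1 + r * s != 0 by rewrite gt_eqF// rs//; case/andP: sal.
  have dv : is_derive s 1 (fun s => (1 + r * s)^-1) (- (1 + r * s) ^- 2 *: r).
    apply: is_deriveV => //; apply: is_derive_eq.
    by rewrite /GRing.scale/=; ring.
  rewrite /h; apply: is_derive_eq.
  by rewrite /GRing.scale/=; field.
have ph s : 0 <= s <= al -> 0 <= p s - (r / (1 + r * s)) ^+ 2.
  move=> sal; rewrite subr_ge0; case/andP: (sal) => s0 sal'.
  have in01' u : 0 <= u <= s -> 0 <= u <= 1.
    by move=> /andP[u0 us]; apply: in01; rewrite u0 (le_trans us).
  by apply: (self_concordant_lower (q := q)) => // u /in01'; auto.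
have := ge_of_derive_ge (ltW al0) dh ph; rewrite mul0r /h g0 add0r mulr0 addr0.
rewrite invr1 mulr1 (mulrC r al) alr => gal.
have gal' : r * w <= g al * (1 + w).
  have w1 : 0 < 1 + w by rewrite addr_gt0.
  have : r * (1 + w) <= (g al + r / (1 + w)) * (1 + w).
    by rewrite ler_pM2r//; lra.
  by rewrite mulrDl divfK ?gt_eqF//; lra.
have gal0 : 0 < g al.
  have : 0 < g al * (1 + w) by apply: lt_le_trans gal'; rewrite mulr_gt0.
  by rewrite pmulr_lgt0// addr_gt0.
have in11 s : al <= s <= 1 -> 0 <= s <= 1.
  by move=> /andP[as_ ->]; rewrite (le_trans _ as_)// ltW.
have gpos s : al <= s <= 1 -> 0 < g s.
  move=> /andP[as_ s1]; apply: lt_le_trans gal0 _.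
  rewrite -subr_ge0 -(mul0r (s - al)); apply: ge_of_derive_ge as_ _ _ => u.
  - by move=> /andP[au us]; apply/dg/in11; rewrite au (le_trans us).
  - by move=> /andP[au us]; apply/p_ge0/in11; rewrite au (le_trans us).
(* On [al, 1] the derivative -p / g^2 of 1 / g is at most -1 / nu, while 1 / g stays positive; hence
   (1 - al) / nu <= 1 / g(al). *)
have dVg s : al <= s <= 1 ->
    is_derive s 1 (fun s => (g s)^-1) (- (g s) ^- 2 *: p s).
  move=> sal; apply: is_deriveV; last exact/dg/in11.
  by rewrite gt_eqF// gpos.
have : (g 1)^-1 - (g al)^-1 <= (- nu^-1) * (1 - al).
  apply: (le_of_derive_le (ltW al1) dVg) => s sal.
  rewrite /GRing.scale/= mulNr lerN2 mulrC.
  rewrite ler_pdivlMr ?exprn_gt0 ?gpos// ler_pdivrMl//.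
  exact/gp/in11.
have : 0 < (g 1)^-1 by rewrite invr_gt0 gpos// (ltW al1) lexx.
move=> g1 gg; have : (1 - al) / nu <= (g al)^-1 by lra.
rewrite ler_pdivrMr// ler_pdivlMl// => gnu.
have : g al * (1 - al) * (r * (1 + w)) <= nu * (r * (1 + w)).
  by rewrite ler_pM2r// mulr_gt0// addr_gt0.
have -> : g al * (1 - al) * (r * (1 + w)) = g al * (1 + w) * (r - al * r) by ring.
rewrite alr nuE => le1.
have le2 : r * w * (r - w) <= w ^+ 2 * (r * (1 + w)).
  by apply: le_trans le1; rewrite ler_wpM2r// subr_ge0 ltW.
have : (r - w) * (r * w) <= (w * (1 + w)) * (r * w) by lra.
by rewrite ler_pM2r ?mulr_gt0//; lra.
Qed.

End one_dimensional.

(** * Directional derivatives *)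

Section directional_derivative_def.
Variables (R : realType) (V : normedModType R).
Implicit Types (f g : V -> R) (x u v w : V) (a b c d e h s : R).

(** A form without quotients, in which changes of base point, direction or increment are plain
    substitutions. *)
Lemma is_deriveP f x u d : is_derive x u f d <->
  forall e, 0 < e -> exists2 dl, 0 < dl & forall h, h != 0 -> `|h| < dl ->
    `|f (x + h *: u) - f x - h * d| <= e * `|h|.
Proof.
pose q (h : R) : R := h^-1 *: ((f \o shift x) (h *: u) - f x).
have qE e h : h != 0 ->
    (`|d - q h| <= e) = (`|f (x + h *: u) - f x - h * d| <= e * `|h|).
  move=> h0; have -> : f (x + h *: u) - f x - h * d = - (d - q h) * h.
    rewrite /q/= /GRing.scale/= (addrC (h *: u)); move: (f _) (f _) => y z.
    by field.
  by rewrite normrM normrN ler_pM2r// normr_gt0.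
have -> : is_derive x u f d <-> q h @[h --> 0^'] --> d.
  split=> [[dfx <-]|qd]; first exact: dfx.
  by split; [apply/cvg_ex; exists d|exact: (cvg_lim _ qd)].
split=> [/cvgrPdist_le qd e e0|H].
  have /qd := e0; rewrite near_withinE near_simpl => /nbhs_normP[dl/= dl0 H].
  exists dl => // h h0 hdl; rewrite -qE//; apply: (H h) => //=.
  by rewrite sub0r normrN.
apply/cvgrPdist_le => e /H[dl dl0 {}H]; rewrite near_withinE near_simpl.
by apply/nbhs_normP; exists dl => // h /=; rewrite sub0r normrN => hdl h0;
  rewrite qE// H.
Qed.

End directional_derivative_def.

Section directional_derivative_theory.
Variables (R : realType) (V : normedModType R).
Implicit Types (f g : V -> R) (x u v w : V) (a b c d e h s : R).

Lemma is_derive_line f x u s d :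
  is_derive (x + s *: u) u f d <-> is_derive s 1 (fun s => f (x + s *: u)) d.
Proof.
have E h : x + s *: u + h *: u = x + (s + h *: 1) *: u.
  by rewrite -addrA -scalerDl /GRing.scale/= mulr1.
by split=> /is_deriveP H; apply/is_deriveP => e /H[dl dl0 {}H]; exists dl => // h;
  have := H h; rewrite E.
Qed.

Lemma is_derive_translate f x u w d :
  is_derive (x + w) u f d -> is_derive x u (fun z => f (z + w)) d.
Proof.
move=> /is_deriveP H; apply/is_deriveP => e /H[dl dl0 {}H]; exists dl => // h.
by have := H h; rewrite (addrAC x).
Qed.

Lemma is_derive_scale f x u c d :
  is_derive x u f d -> is_derive x (c *: u) f (c * d).
Proof.
move=> /is_deriveP H; apply/is_deriveP => e e0.
have [->|c0] := eqVneq c 0.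
  by exists 1 => // h _ _; rewrite scale0r scaler0 addr0 mul0r mulr0 !subrr
    normr0 mulr_ge0// ltW.
have nc : 0 < `|c| by rewrite normr_gt0.
have [dl dl0 {}H] := H _ (divr_gt0 e0 nc).
exists (dl / `|c|); first exact: divr_gt0.
move=> h h0; rewrite ltr_pdivlMr// -normrM => hc.
have := H (h * c); rewrite mulf_neq0// => /(_ isT hc).
have -> : e / `|c| * `|h * c| = e * `|h|.
  by rewrite normrM; field; rewrite gt_eqF.
by rewrite -scalerA -mulrA.
Qed.

Lemma derive_scale f x u c : derivable f x u -> 'D_(c *: u) f x = c * 'D_u f x.
Proof. by move=> /derivableP/is_derive_scale -/(_ c)[]. Qed.

Lemma MVT_direction f x u : (forall s, 0 <= s <= 1 -> derivable f (x + s *: u) u) ->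
  exists2 s, 0 < s < 1 & f (x + u) - f x = 'D_u f (x + s *: u).
Proof.
move=> df; have [s|s s01] := @MVT_cc _ (fun s => f (x + s *: u))
  (fun s => 'D_u f (x + s *: u)) 0 1 ltr01.
- by move=> /df/derivableP/is_derive_line.
- by rewrite scale1r scale0r addr0 subr0 mulr1 => fE; exists s.
Qed.

Lemma nbhs_plane (P : set V) x u v : nbhs x P ->
  exists2 dl, 0 < dl & forall a b, `|a| <= dl -> `|b| <= dl ->
    P (x + a *: u + b *: v).
Proof.
move=> /nbhs_normP[e /= e0 eP].
have uv0 : 0 < `|u| + `|v| + 1 by rewrite ltr_wpDl// addr_ge0.
exists (e / (`|u| + `|v| + 1)); first exact: divr_gt0.
move=> a b ae be; apply: eP => /=.
rewrite -addrA opprD addrA subrr sub0r normrN.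
apply: le_lt_trans (ler_normD _ _) _; rewrite !normrZ.
set k := e / _ in ae be.
have ke : k * (`|u| + `|v| + 1) = e by rewrite divfK// gt_eqF.
have k0 : 0 < k by exact: divr_gt0.
have := ler_wpM2r (normr_ge0 u) ae; have := ler_wpM2r (normr_ge0 v) be.
by lra.
Qed.

(** Directional derivatives need not be additive in the direction. Here f(x + hu + hv) - f(x + hu)
    is h times ['D_v f] at an intermediate point, and continuity of ['D_v f] at [x] concludes. *)
Lemma is_derive_additive f x u v :
  (\forall z \near x, derivable f z v) -> derivable f x u ->
  {for x, continuous ('D_v f)} -> is_derive x (u + v) f ('D_u f x + 'D_v f x).
Proof.
move=> dv /derivableP/is_deriveP du cv; apply/is_deriveP => e e0.
have e2 : 0 < e / 2 by rewrite divr_gt0.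
have [dl dl0 {}du] := du _ e2.
have /cvgrPdist_le /(_ _ e2) cv' := cv.
have [dl' dl'0 P] := nbhs_plane u v (filterI dv cv').
exists (Num.min dl dl'); first by rewrite lt_min dl0.
move=> h h0; rewrite lt_min => /andP[hdl hdl'].
have hP s : 0 <= s <= 1 -> `|s * h| <= dl'.
  move=> /andP[s0 s1]; apply: le_trans (ltW hdl').
  by rewrite normrM ger0_norm// ler_piMl.
have Ps s : 0 <= s <= 1 -> derivable f (x + h *: u + s *: (h *: v)) v /\
   `|'D_v f x - 'D_v f (x + h *: u + s *: (h *: v))| <= e / 2.
  by move=> s01; rewrite scalerA; apply: P; [exact: ltW|exact: hP].
have [s|s /andP[s0 s1] fs] := @MVT_direction f (x + h *: u) (h *: v).
  by move=> /Ps[/derivableP/is_derive_scale -/(_ h)[]].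
have [dfs ef] : derivable f (x + h *: u + s *: (h *: v)) v /\
   `|'D_v f x - 'D_v f (x + h *: u + s *: (h *: v))| <= e / 2.
  by apply: Ps; rewrite !ltW.
rewrite (derive_scale _ dfs) in fs.
rewrite scalerDr addrA -(subrK (f (x + h *: u)) (f (_ + h *: v))) fs.
set du' := 'D_u f x; set dv' := 'D_v f x in ef *; set k := 'D_v f _ in ef *.
have -> : h * k + f (x + h *: u) - f x - h * (du' + dv') =
  (f (x + h *: u) - f x - h * du') + - (h * (dv' - k)) by ring.
apply: le_trans (ler_normD _ _) _.
have := du h h0 hdl; rewrite normrN normrM -/du'.
by have := ler_wpM2l (normr_ge0 h) ef; lra.
Qed.

Lemma derive_symmetric f x u v :
  (\forall z \near x, [/\ derivable f z u, derivable f z v,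
     derivable ('D_u f) z v & derivable ('D_v f) z u]) ->
  {for x, continuous ('D_v ('D_u f))} -> {for x, continuous ('D_u ('D_v f))} ->
  'D_v ('D_u f) x = 'D_u ('D_v f) x.
Proof.
(* The second difference of [f] along [h u] and [h v] is both
   [h^2 D_v D_u f] and [h^2 D_u D_v f] at points close to [x]. *)
have le11 : 0 <= (1 : R) <= 1 by rewrite ler01 lexx.
have le00 : 0 <= (0 : R) <= 1 by rewrite ler01 lexx.
have half u' v' h : h != 0 ->
    (forall s s', 0 <= s <= 1 -> 0 <= s' <= 1 ->
       derivable f (x + (s * h) *: u' + (s' * h) *: v') u' /\
       derivable ('D_u' f) (x + (s * h) *: u' + (s' * h) *: v') v') ->
    exists s s', [/\ 0 <= s <= 1, 0 <= s' <= 1 &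
      f (x + h *: u' + h *: v') - f (x + h *: u') - f (x + h *: v') + f x =
      h ^+ 2 * 'D_v' ('D_u' f) (x + (s * h) *: u' + (s' * h) *: v')].
  move=> h0 df.
  pose g z := f (z + h *: v') - f z.
  have dg s : 0 <= s <= 1 -> is_derive (x + s *: (h *: u')) u' g
      ('D_u' f (x + (s * h) *: u' + h *: v') - 'D_u' f (x + (s * h) *: u')).
    move=> s01; rewrite scalerA /g; apply: is_deriveB.
    - apply: is_derive_translate; apply/derivableP.
      by have [+ _] := df s 1 s01 le11; rewrite mul1r; exact.
    - apply/derivableP; have [+ _] := df s 0 s01 le00.
      by rewrite mul0r scale0r addr0; exact.
  have [s s01|s /andP[s0 s1] gE] := @MVT_direction g x (h *: u').
    by have [] := is_derive_scale h (dg _ s01).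
  have s01 : 0 <= s <= 1 by rewrite !ltW.
  have [s' s'01|s' /andP[s'0 s'1] duE] :=
    @MVT_direction ('D_u' f) (x + (s * h) *: u') (h *: v').
    rewrite scalerA; have [_ /derivableP ds] := df s s' s01 s'01.
    by have [] := is_derive_scale h ds.
  have s'01 : 0 <= s' <= 1 by rewrite !ltW.
  exists s, s'; split => //.
  have -> : f (x + h *: u' + h *: v') - f (x + h *: u') - f (x + h *: v') + f x
    = g (x + h *: u') - g x by rewrite /g; ring.
  have [dgs dgsE] := dg _ s01.
  rewrite gE derive_scale// dgsE duE derive_scale ?scalerA; first by ring.
  by have [] := df s s' s01 s'01.
move=> df cvu cuv; apply/eqP; rewrite -subr_eq0 -normr_le0.
apply/ler_addgt0Pr => e e0; rewrite add0r.
have e2 : 0 < e / 2 by rewrite divr_gt0.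
have /cvgrPdist_le /(_ _ e2) cvu' := cvu.
have /cvgrPdist_le /(_ _ e2) cuv' := cuv.
have [dl dl0 P] : exists2 dl, 0 < dl & forall a b, `|a| <= dl -> `|b| <= dl ->
    let z := x + a *: u + b *: v in
    [/\ derivable f z u, derivable f z v,
        derivable ('D_u f) z v & derivable ('D_v f) z u] /\
    `|'D_v ('D_u f) x - 'D_v ('D_u f) z| <= e / 2 /\
    `|'D_u ('D_v f) x - 'D_u ('D_v f) z| <= e / 2.
  exact: nbhs_plane u v (filterI df (filterI cvu' cuv')).
have sdl s : 0 <= s <= 1 -> `|s * dl| <= dl.
  by move=> /andP[s0 s1]; rewrite normrM !ger0_norm ?(ltW dl0)// ler_piMl// ltW.
have dl_neq0 : dl != 0 by rewrite gt_eqF.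
have [s s' s01 s'01|s [s' [s01 s'01 E1]]] := half u v dl dl_neq0.
  by have [[fu _ fuv _] _] := P _ _ (sdl s s01) (sdl s' s'01).
have [r r' r01 r'01|r [r' [r01 r'01 E2]]] := half v u dl dl_neq0.
  have [[_ fv _ fvu] _] := P _ _ (sdl r' r'01) (sdl r r01).
  by rewrite (addrAC x); split; [exact: fv|exact: fvu].
rewrite (addrAC x (r * dl *: v)) (addrAC x (dl *: v)) in E2.
rewrite (addrAC _ (- f (x + dl *: v))) E1 in E2.
have [_ [+ _]] := P _ _ (sdl s s01) (sdl s' s'01).
have [_ [_ +]] := P _ _ (sdl r' r'01) (sdl r r01).
have -> : 'D_v ('D_u f) (x + (s * dl) *: u + (s' * dl) *: v) =
          'D_u ('D_v f) (x + (r' * dl) *: u + (r * dl) *: v).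
  have dl2 : dl ^+ 2 != 0 by rewrite expf_neq0.
  exact: mulfI dl2 _ _ E2.
clear; move: ('D_v ('D_u f) x) ('D_u ('D_v f) x) ('D_u ('D_v f) _) => y z k.
rewrite !ler_distl => /andP[? ?] /andP[? ?].
apply/andP; split; lra.
Qed.

End directional_derivative_theory.

(** * Second-order calculus on an open set *)

Section interiors_and_convexity.
Variables (R : realType) (n : nat).
Implicit Types (X D : set 'cV[R]_n) (x z u : 'cV[R]_n) (s a : R).

Lemma convex_setP X : convex_set (X : set (convex_lmodType 'cV[R]_n)) ->
  forall x z s, X x -> X z -> 0 <= s <= 1 -> X (x + s *: (z - x)).
Proof.
move=> cX x z s Xx Xz /andP[s0 s1].
have := cX z x (Itv01 s0 s1); rewrite !inE => /(_ Xz Xx).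
suff -> : x + s *: (z - x) = s *: z + (1 - s) *: x by [].
by rewrite scalerBr scalerBl scale1r addrCA.
Qed.

Lemma interior_segment X x z s :
  convex_set (X : set (convex_lmodType 'cV[R]_n)) ->
  X° x -> X z -> 0 <= s < 1 -> X° (x + s *: (z - x)).
Proof.
move=> cX /nbhs_normP[e /= e0 eX] Xz /andP[s0 s1].
have s1' : 0 < 1 - s by rewrite subr_gt0.
apply/(@nbhs_normP _ _ _ X); exists (e * (1 - s)) => /=; first exact: mulr_gt0.
(* The preimage of [w] by the homothety of center [z] and ratio 1 - s, which shrinks the ball around
   [x] into one around the new point. *)
move=> w /= wP; pose y := x + (1 - s)^-1 *: (w - (x + s *: (z - x))).
have -> : w = y + s *: (z - y).
  rewrite /y; apply/colP => i; rewrite !mxE; field; lra.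
apply: convex_setP; rewrite ?s0 ?ltW//; apply: eX => /=.
rewrite /y opprD addrA subrr sub0r normrN normrZ normfV (gtr0_norm s1').
by rewrite ltr_pdivrMl// mulrC distrC.
Qed.

Lemma interior_segment_cc X x z s :
  convex_set (X : set (convex_lmodType 'cV[R]_n)) ->
  X° x -> X° z -> 0 <= s <= 1 -> X° (x + s *: (z - x)).
Proof.
move=> cX Xx Xz /andP[s0]; rewrite le_eqVlt => /predU1P[->|s1].
  by rewrite scale1r addrC subrK.
by apply: interior_segment; rewrite ?s0//; exact: interior_subset.
Qed.

End interiors_and_convexity.

Section second_order.
Variables (R : realType) (n : nat) (D : set 'cV[R]_n) (F : 'cV[R]_n -> R).
Implicit Types (x z u v w : 'cV[R]_n) (s a : R).
Hypotheses (openD : open D).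

Lemma open_near (P : 'cV[R]_n -> Prop) x :
  (forall z, D z -> P z) -> D x -> \forall z \near x, P z.
Proof. by move=> DP Dx; apply: filterS DP _; apply: open_nbhs_nbhs. Qed.

Section first_order.
Variables (f : 'cV[R]_n -> R) (x : 'cV[R]_n).
Hypotheses (Cf : class_C 1 D f) (Dx : D x).

Lemma class_C_deriveD u v : 'D_(u + v) f x = 'D_u f x + 'D_v f x.
Proof.
case: Cf => _ C1; have [] // := @is_derive_additive _ _ f x u v.
- by apply: open_near Dx => z Dz; have [+ _] := C1 v; exact.
- by have [+ _] := C1 u; exact.
- by have [_ [+ _]] := C1 v; exact.
Qed.

Lemma class_C_deriveZ a u : 'D_(a *: u) f x = a * 'D_u f x.
Proof. by case: Cf => _ C1; apply: derive_scale; have [+ _] := C1 u; exact. Qed.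

Lemma class_C_derive_sum (I : Type) (r : seq I) (a : I -> R)
    (w : I -> 'cV[R]_n) :
  'D_(\sum_(i <- r) a i *: w i) f x = \sum_(i <- r) a i * 'D_(w i) f x.
Proof.
elim: r => [|i r IHr]; first by rewrite !big_nil derive0.
by rewrite !big_cons class_C_deriveD class_C_deriveZ IHr.
Qed.

Lemma class_C_derive_grad u : 'D_u f x = dotv (grad f x) u.
Proof.
rewrite {1}(matrix_sum_delta u) dotvE.
under eq_bigr do rewrite big_ord1.
by rewrite class_C_derive_sum; apply: eq_bigr => i _; rewrite mxE mulrC.
Qed.

End first_order.

Hypothesis C2F : class_C 2 D F.

Lemma class_C_derive1 u : class_C 1 D ('D_u F).
Proof. by have [_ /(_ u)[]] := C2F. Qed.

Lemma class_C_sym x u v : D x -> 'D_v ('D_u F) x = 'D_u ('D_v F) x.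
Proof.
have [_ C1] := C2F => Dx.
have C1' w := (C1 w).2.2.
apply: derive_symmetric.
- apply: open_near Dx => z Dz; split.
  + by have [+ _] := C1 u; exact.
  + by have [+ _] := C1 v; exact.
  + by have [+ _] := C1' u v; exact.
  + by have [+ _] := C1' v u; exact.
- by have [_ [+ _]] := C1' u v; exact.
- by have [_ [+ _]] := C1' v u; exact.
Qed.

(** Linearity is applied to the outer direction only; symmetry brings each of the two directions
    outside in turn. *)
Lemma hessianE x u v : D x -> dotv u (hessian F x *m v) = 'D_v ('D_u F) x.
Proof.
move=> Dx; rewrite class_C_sym// class_C_derive_grad//; last first.
  exact: class_C_derive1.
rewrite dotvC; congr dotv; apply/colP => i; rewrite !mxE.
rewrite class_C_sym// class_C_derive_grad//; last exact: class_C_derive1.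
by rewrite dotvE; apply: eq_bigr => j _; rewrite !mxE class_C_sym.
Qed.

End second_order.

(** * Self-concordant barriers *)

(** Converts the defining inequality of the barrier parameter, scaled by every c, into its
    homogeneous form. *)
Lemma quadratic_bound (R : realFieldType) (g p nu : R) :
  (forall c, 2 * c * g - c ^+ 2 * p <= nu) -> 0 <= p /\ g ^+ 2 <= nu * p.
Proof.
move=> H; have nu0 : 0 <= nu by have := H 0; lra.
have p0 : 0 <= p.
  (* The values at c + 1 and -(c + 1) average to (c + 1)^2 (-p), which exceeds c (-p) = nu + 1. *)
  rewrite leNgt; apply/negP => p0; pose c := (nu + 1) / - p.
  have cp : c * - p = nu + 1 by rewrite divfK// gt_eqF// oppr_gt0.
  have c0 : 0 < c by rewrite divr_gt0 ?oppr_gt0// ltr_wpDl.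
  by have := H (c + 1); have := H (- (c + 1)); nra.
split=> //; move: p0; rewrite le_eqVlt => /predU1P[p0|p0].
  rewrite -p0 mulr0; have [->|g0] := eqVneq g 0; first by rewrite expr0n.
  have := H ((nu + 1) / (2 * g)); rewrite -p0 mulr0 subr0.
  have -> : 2 * ((nu + 1) / (2 * g)) * g = nu + 1 by field.
  by lra.
have := H (g / p); have -> : 2 * (g / p) * g - (g / p) ^+ 2 * p = g ^+ 2 / p.
  by field; rewrite gt_eqF.
by rewrite ler_pdivrMr.
Qed.

Lemma derive_interior_argmin (R : realType) (V : normedModType R) (X : set V)
  (f : V -> R) x u : is_argmin X° f x -> derivable f x u -> 'D_u f x = 0.
Proof.
move=> [Xx xmin] /derivableP/is_deriveP dfx; apply/eqP; apply: contraT => d0.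
set d := 'D_u f x in dfx d0.
have d2 : 0 < `|d| / 2 by rewrite divr_gt0// normr_gt0.
have [dl dl0 {}dfx] := dfx _ d2.
have [dl' dl'0 P] := nbhs_plane u 0 (open_nbhs_nbhs (conj (open_interior X) Xx)).
(* A move against the sign of the slope: the first-order decrease |d| |h| beats the error |d| |h| /
   2. *)
pose h := - Num.sg d * (Num.min dl dl' / 2).
have m0 : 0 < Num.min dl dl' / 2 by rewrite divr_gt0// lt_min dl0.
have nh : `|h| = Num.min dl dl' / 2.
  by rewrite normrM normrN normr_sg d0 mul1r gtr0_norm.
have h0 : h != 0 by rewrite -normr_gt0 nh.
have mm : Num.min dl dl' / 2 < Num.min dl dl'.
  by move: m0; set m := Num.min _ _; lra.
have := dfx h h0; rewrite nh (lt_le_trans mm) ?ge_min ?lexx// => /(_ isT).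
have Dh : X° (x + h *: u).
  have := P h 0; rewrite nh normr0 scaler0 addr0; apply; last exact: ltW.
  by rewrite (le_trans (ltW mm))// ge_min lexx orbT.
have hd : h * d = - (`|d| * (Num.min dl dl' / 2)).
  by rewrite /h [in RHS]normrEsg; ring.
rewrite hd => /(le_trans (ler_norm _)).
have := xmin _ Dh; have : 0 < `|d| * (Num.min dl dl' / 2).
  by rewrite mulr_gt0// normr_gt0.
move: (f _) (f x) => y z; set m := Num.min _ _; nra.
Qed.

Section barrier.
Variables (R : realType) (n : nat) (X : set 'cV[R]_n) (nu : R).
Variables (F : 'cV[R]_n -> R) (xc : 'cV[R]_n).
Implicit Types (x z u : 'cV[R]_n) (s a : R).
Hypothesis convX : convex_set (X : set (convex_lmodType 'cV[R]_n)).
Hypothesis nu_gt0 : 0 < nu.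
Hypothesis barF : self_concordant_barrier X nu F.
Hypothesis xcmin : is_argmin X° F xc.

Let C3F : class_C 3 X° F. Proof. exact: sc_C3 (scb_sc barF). Qed.
Let openX : open X° := open_interior X.

Lemma barrier_C2 : class_C 2 X° F.
Proof.
case: C3F => cF H; split; first exact: cF.
move=> u; case: (H u) => dF [cdF H']; split; first exact: dF.
split; first exact: cdF.
by move=> v; case: (H' v) => ddF [cddF _]; split; [exact: ddF|split].
Qed.

Lemma barrier_C1 : class_C 1 X° F.
Proof.
case: barrier_C2 => cF H; split; first exact: cF.
by move=> u; case: (H u) => dF [cdF _]; split; [exact: dF|split].
Qed.

Lemma derive_barrier x u : X° x -> is_derive x u F ('D_u F x).
Proof. by move=> Xx; apply/derivableP; have [_ /(_ u)[+ _]] := C3F; exact. Qed.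

Lemma derive2_barrier x u v : X° x -> is_derive x v ('D_u F) ('D_v ('D_u F) x).
Proof.
move=> Xx; apply/derivableP.
by have [_ /(_ u)[_ [_ /(_ v)[+ _]]]] := C3F; exact.
Qed.

Lemma derive3_barrier x u v w : X° x ->
  is_derive x w ('D_v ('D_u F)) ('D_w ('D_v ('D_u F)) x).
Proof.
move=> Xx; apply/derivableP.
by have [_ /(_ u)[_ [_ /(_ v)[_ [_ /(_ w)[+ _]]]]]] := C3F; exact.
Qed.

Lemma derive_barrier_line x u s : X° (x + s *: u) ->
  is_derive s 1 (fun s => F (x + s *: u)) ('D_u F (x + s *: u)).
Proof.
move=> Xs; exact: (iffLR (@is_derive_line R _ F x u s _) (derive_barrier u Xs)).
Qed.

Lemma derive2_barrier_line x u s : X° (x + s *: u) ->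
  is_derive s 1 (fun s => 'D_u F (x + s *: u)) ('D_u ('D_u F) (x + s *: u)).
Proof.
move=> Xs.
exact: (iffLR (@is_derive_line R _ ('D_u F) x u s _) (derive2_barrier u u Xs)).
Qed.

Lemma derive3_barrier_line x u s : X° (x + s *: u) ->
  is_derive s 1 (fun s => 'D_u ('D_u F) (x + s *: u))
    ('D_u ('D_u ('D_u F)) (x + s *: u)).
Proof.
move=> Xs; exact: (iffLR (@is_derive_line R _ ('D_u ('D_u F)) x u s _)
  (derive3_barrier u u u Xs)).
Qed.

Lemma barrier_parameter x u : X° x ->
  0 <= 'D_u ('D_u F) x /\ 'D_u F x ^+ 2 <= nu * 'D_u ('D_u F) x.
Proof.
move=> Xx; apply: quadratic_bound => c.
have := scb_parameter barF (c *: u) Xx.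
rewrite -(class_C_derive_grad openX barrier_C1 Xx).
rewrite (class_C_deriveZ barrier_C1 Xx).
rewrite -scalemxAr dotvZl dotvZr (hessianE openX barrier_C2)//.
by congr (_ <= _); ring.
Qed.

Lemma barrier_hess_ge0 x u : X° x -> 0 <= 'D_u ('D_u F) x.
Proof. by case/(barrier_parameter u). Qed.

Lemma barrier_third x u : X° x ->
  `|'D_u ('D_u ('D_u F)) x| <= 2 * 'D_u ('D_u F) x `^ (3 / 2).
Proof.
move=> Xx; rewrite -(hessianE openX barrier_C2)//.
exact: sc_third (scb_sc barF) _ _ Xx.
Qed.

Lemma barrier_radius_int z : X° z ->
  'D_(z - xc) ('D_(z - xc) F) xc <= (nu + 2 * Num.sqrt nu) ^+ 2.
Proof.
move=> Xz; set u := z - xc; have Xs s : 0 <= s <= 1 -> X° (xc + s *: u).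
  by move=> s01; apply: interior_segment_cc => //; case: xcmin.
have := @barrier_radius_1d _ (fun s => 'D_u F (xc + s *: u))
  (fun s => 'D_u ('D_u F) (xc + s *: u))
  (fun s => 'D_u ('D_u ('D_u F)) (xc + s *: u)) nu nu_gt0.
rewrite scale0r addr0; apply.
- by move=> s /Xs Xx; exact/derive2_barrier_line.
- by move=> s /Xs Xx; exact/derive3_barrier_line.
- by move=> s /Xs; exact: barrier_hess_ge0.
- by move=> s /Xs; exact: barrier_third.
- by move=> s /Xs/(barrier_parameter u)[].
- apply: (derive_interior_argmin xcmin).
  by case: (derive_barrier u (proj1 xcmin)).
Qed.

Let Q u := 'D_u ('D_u F) xc.

Lemma barrier_hessZ a u x : X° x ->
  'D_(a *: u) ('D_(a *: u) F) x = a ^+ 2 * 'D_u ('D_u F) x.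
Proof.
move=> Xx; rewrite -(hessianE openX barrier_C2 (a *: u) (a *: u) Xx).
rewrite -(hessianE openX barrier_C2 u u Xx) -scalemxAr dotvZl dotvZr.
by ring.
Qed.

Lemma barrier_hess_parallelogram u v x : X° x ->
  'D_(u + v) ('D_(u + v) F) x + 'D_(u - v) ('D_(u - v) F) x =
  2 * 'D_u ('D_u F) x + 2 * 'D_v ('D_v F) x.
Proof.
move=> Xx; rewrite -(hessianE openX barrier_C2 (u + v) (u + v) Xx).
rewrite -(hessianE openX barrier_C2 (u - v) (u - v) Xx).
rewrite -(hessianE openX barrier_C2 u u Xx) -(hessianE openX barrier_C2 v v Xx).
by rewrite !mulmxDr !mulmxN !dotvDl !dotvDr !dotvNl !dotvNr; ring.
Qed.

(** If u + v and u - v lie in an ellipsoid centered at 0, so does v, whatever u is: this moves the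
    center from [xc] to another point. *)
Lemma barrier_hess_midpoint u v x k : X° x ->
  'D_(u + v) ('D_(u + v) F) x <= k -> 'D_(u - v) ('D_(u - v) F) x <= k ->
  'D_v ('D_v F) x <= k.
Proof.
move=> Xx pk mk; rewrite -(ler_pM2l (ltr0Sn R 1)) -(lerD2l (2 * 'D_u ('D_u F) x)).
rewrite -(barrier_hess_parallelogram u v Xx).
apply: le_trans (lerD pk mk) _; have -> : k + k = 2 * k by ring.
by rewrite lerDr mulr_ge0// barrier_hess_ge0.
Qed.

(** Boundary points are reached as limits of xc + s (z - xc), s < 1, which are interior. *)
Lemma barrier_radius z : X z ->
  'D_(z - xc) ('D_(z - xc) F) xc <= (nu + 2 * Num.sqrt nu) ^+ 2.
Proof.
move=> Xz; set u := z - xc; set k := (_ ^+ 2 in leRHS).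
have Xxc : X° xc by case: xcmin.
have kap0 : 0 < k by rewrite exprn_gt0// ltr_pwDl// mulr_ge0// sqrtr_ge0.
have Qs s : 0 <= s < 1 -> s ^+ 2 * Q u <= k.
  move=> s01; rewrite -barrier_hessZ//.
  have := barrier_radius_int (interior_segment convX Xxc Xz s01).
  by rewrite addrC addKr.
rewrite leNgt; apply/negP; rewrite -/(Q u) => kQ.
have Q0 : 0 < Q u by apply: lt_trans kQ.
(* If k < Q u, this s^2 is the midpoint of k / Q u and 1, so that s < 1 but s^2 Q u > k. *)
pose s := Num.sqrt ((k / Q u + 1) / 2).
have kQ1 : k / Q u < 1 by rewrite ltr_pdivrMr// mul1r.
have kQ0 : 0 < k / Q u by exact: divr_gt0.
have sE : s ^+ 2 = (k / Q u + 1) / 2 by rewrite sqr_sqrtr//; lra.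
have s1 : s < 1 by rewrite -[ltRHS]sqrtr1 ltr_sqrt//; lra.
have := Qs s; rewrite s1 sqrtr_ge0 sE => /(_ isT).
by rewrite -ler_pdivlMr//; lra.
Qed.

(** Continuation along the segment: F stays bounded on it, whereas it tends to infinity at the
    boundary, so the segment cannot leave the interior. *)
Lemma dikin x u : X° x -> 'D_u ('D_u F) x < 1 -> X° (x + u).
Proof.
move=> Xx p1; pose p s := 'D_u ('D_u F) (x + s *: u).
pose S := [set a : R | 0 <= a <= 1 /\ forall s, 0 <= s <= a -> X° (x + s *: u)].
have S0 : S 0.
  rewrite /S/= lexx ler01; split => // s /le_anti <-.
  by rewrite scale0r addr0.
have ubS : has_ubound S by exists 1 => a [/andP[]].
have supS : has_sup S by split; [exists 0|].
have sup0 : 0 <= sup S by apply: ub_le_sup.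
have sup1 : sup S <= 1 by apply: ge_sup => [|a [/andP[]]//]; exists 0.
have SX s : 0 <= s < sup S -> X° (x + s *: u).
  move=> /andP[s0 sS]; have [a [_ aX] sa] := sup_gt supS.1 sS.
  by apply: aX; rewrite s0 ltW.
have p00 : 0 <= 'D_u ('D_u F) x by exact: barrier_hess_ge0.
(* Strictly between the local length of [u] and 1, so that the bound of [self_concordant_upper] is
   uniform in s <= 1. *)
pose b := Num.sqrt ((1 + 'D_u ('D_u F) x) / 2).
have bE : b ^+ 2 = (1 + 'D_u ('D_u F) x) / 2 by rewrite sqr_sqrtr//; lra.
have b0 : 0 <= b by exact: sqrtr_ge0.
have b1 : b < 1 by rewrite -[ltRHS]sqrtr1 ltr_sqrt//; lra.
pose C := (b / (1 - b)) ^+ 2.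
have pC s : 0 <= s <= 1 -> (forall s', 0 <= s' <= s -> X° (x + s' *: u)) -> p s <= C.
  move=> /andP[s0 s1] sX.
  have sb : s * b < 1 by apply: le_lt_trans b1; rewrite ler_piMl.
  apply: (@le_trans _ _ ((b / (1 - s * b)) ^+ 2)).
    apply: (@self_concordant_upper _ p
      (fun s => 'D_u ('D_u ('D_u F)) (x + s *: u)) s b s0 b0 _ sb).
    - by rewrite /p scale0r addr0 bE; lra.
    - by move=> r /sX Xr; exact/derive3_barrier_line.
    - by move=> r /sX; exact: barrier_hess_ge0.
    - by move=> r /sX; exact: barrier_third.
  rewrite ler_sqr ?nnegrE ?divr_ge0 ?subr_ge0 ?(ltW sb) ?(ltW b1)//.
  rewrite ler_wpM2l// lef_pV2 ?posrE ?subr_gt0// lerB// ler_piMl//.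
pose M := F x + `|'D_u F x| + C.
have FM s : 0 <= s <= 1 -> (forall s', 0 <= s' <= s -> X° (x + s' *: u)) ->
    F (x + s *: u) <= M.
  move=> s01 sX.
  have := @upper_bound_1d _ (fun s => F (x + s *: u)) (fun s => 'D_u F (x + s *: u)) p C s s01 (sqr_ge0 _).
  rewrite scale0r addr0; apply => r r0s.
  - exact/derive_barrier_line/sX.
  - exact/derive2_barrier_line/sX.
  - apply: pC => [|r' /andP[r'0 r'r]].
      by case/andP: r0s => ->/= rs; rewrite (le_trans rs)//; case/andP: s01.
    by apply: sX; rewrite r'0 (le_trans r'r)//; case/andP: r0s.
have near_path a B : nbhs (x + a *: u) B ->
    exists2 dl, 0 < dl & forall s, `|s - a| <= dl -> B (x + s *: u).
  move=> /(nbhs_plane u 0)[dl dl0 P]; exists dl => // s sa.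
  have := P (s - a) 0 sa; rewrite normr0 scaler0 addr0 => /(_ (ltW dl0)).
  by rewrite -addrA -scalerDl subrKC.
have sup_gt0 : 0 < sup S.
  have : nbhs (x + 0 *: u) X°.
    by rewrite scale0r addr0; exact: open_nbhs_nbhs (conj openX Xx).
  move=> /near_path[dl dl0 P].
  apply: (@lt_le_trans _ _ (Num.min dl 1)); first by rewrite lt_min dl0 ltr01.
  apply: (ub_le_sup ubS); split=> [|s /andP[s0]].
    by rewrite ge_min lexx orbT le_min ltW// ler01.
  by rewrite le_min => /andP[sdl _]; apply: P; rewrite subr0 ger0_norm.
have close_path B : nbhs (x + sup S *: u) B ->
    exists2 s, 0 <= s < sup S & B (x + s *: u).
  move=> /near_path[dl dl0 P]; pose m := Num.min dl (sup S).
  have m0 : 0 < m by rewrite lt_min dl0.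
  have mdl : m <= dl by rewrite ge_min lexx.
  have mS : m <= sup S by rewrite ge_min lexx orbT.
  exists (sup S - m); first by apply/andP; split; lra.
  by apply: P; rewrite addrAC subrr sub0r normrN gtr0_norm.
(* Otherwise this limit of interior points is a boundary point, and F exceeds [M] somewhere on the
   path before it. *)
have Xsup : X° (x + sup S *: u).
  apply: contrapT => nX.
  have cX : (closure X° `\` X°) (x + sup S *: u).
    split; last exact: nX.
    by move=> B /close_path[s /SX Xs Bs]; exists (x + s *: u); exact: conj Xs Bs.
  have /cvgryPgt/(_ M) := scb_boundary barF cX.
  rewrite near_withinE => /close_path[s s01] /(_ (SX _ s01)).
  apply/negP; rewrite -leNgt; apply: FM.
    by case/andP: s01 => -> ss; rewrite ltW// (lt_le_trans ss).
  move=> s' /andP[s'0 s's]; apply: SX; rewrite s'0 (le_lt_trans s's)//.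
  by case/andP: s01.
move: sup1; rewrite le_eqVlt => /predU1P[s1|s1].
  by move: Xsup; rewrite s1 scale1r.
(* Openness prolongs the path beyond [sup S], a contradiction if [sup S] < 1. *)
have [dl dl0 P] := near_path _ _ (open_nbhs_nbhs (conj openX Xsup)).
pose a := Num.min (sup S + dl) 1.
have aS : sup S < a by rewrite lt_min s1 ltrDl dl0.
move: (aS); rewrite ltNge => /negP; case.
apply: (ub_le_sup ubS); split=> [|s /andP[s0 sa]].
  by rewrite ge_min lexx orbT (le_trans sup0)// ltW.
have [ss|sS] := ltP s (sup S); first by apply: SX; apply/andP.
apply: P; rewrite ger0_norm ?subr_ge0// lerBlDl.
by move: sa; rewrite le_min => /andP[].
Qed.

(** The Dikin ellipsoid at [x] is contained in X, hence in the large ellipsoid around [xc];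
    recentering and comparing their extents along [u] compares the two Hessians. *)
Lemma barrier_hess_lower x u : X° x ->
  'D_u ('D_u F) xc <= (nu + 2 * Num.sqrt nu) ^+ 2 * 'D_u ('D_u F) x.
Proof.
move=> Xx; set k := (_ ^+ 2 in leRHS).
have Xxc : X° xc by case: xcmin.
have k0 : 0 < k by rewrite exprn_gt0// ltr_pwDl// mulr_ge0// sqrtr_ge0.
have p0 := barrier_hess_ge0 u Xx.
have step c : c ^+ 2 * 'D_u ('D_u F) x < 1 -> c ^+ 2 * 'D_u ('D_u F) xc <= k.
  move=> c1; have Xp : X (x + c *: u).
    by apply: interior_subset; apply: dikin => //; rewrite barrier_hessZ.
  have Xm : X (x - c *: u).
    apply: interior_subset; rewrite -scaleNr; apply: dikin => //.
    by rewrite barrier_hessZ// sqrrN.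
  have xp : x + c *: u - xc = x - xc + c *: u by rewrite addrAC.
  have xm : x - c *: u - xc = x - xc - c *: u by rewrite addrAC.
  rewrite -(barrier_hessZ c u Xxc).
  apply: (@barrier_hess_midpoint (x - xc)) => //.
    by rewrite -xp; exact: barrier_radius.
  by rewrite -xm; exact: barrier_radius.
apply/ler_addgt0Pr => e e0.
(* c = 1 / sqrt d is admissible even if the Hessian vanishes along [u] at [x], and k d exceeds the
   target by e only. *)
pose d := 'D_u ('D_u F) x + e / k.
have d0 : 0 < d by rewrite ltr_wpDl// divr_gt0.
have := step (Num.sqrt d)^-1; rewrite exprVn sqr_sqrtr ?(ltW d0)//.
rewrite ltr_pdivrMl// mulr1 ltrDl divr_gt0// => /(_ isT).
by rewrite ler_pdivrMl// /d mulrDl divfK ?gt_eqF// mulrC.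
Qed.

(** In a direction where the Hessian vanishes, the Dikin ellipsoid would contain a whole line of
    X. *)
Lemma barrier_hess_gt0 u : bounded_set X -> u != 0 -> 0 < 'D_u ('D_u F) xc.
Proof.
have Xxc : X° xc by case: xcmin.
move=> [M [_ XM]] u0; rewrite lt_neqAle barrier_hess_ge0// andbT.
apply/negP => /eqP Q0.
have Xc c : X (xc + c *: u).
  by apply: interior_subset; apply: dikin => //; rewrite barrier_hessZ// -Q0 mulr0.
have nu0' : 0 < `|u| by rewrite normr_gt0.
have XM1 x : X x -> `|x| <= M + 1 by apply: XM; rewrite ltrDl.
pose c := (M + 1 + `|xc| + 1) / `|u|.
have M1 : 0 <= M + 1 by apply: le_trans (XM1 _ (interior_subset Xxc)).
have c0 : 0 <= c by rewrite divr_ge0// addr_ge0// addr_ge0.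
have := XM1 _ (Xc c); have := ler_normB (xc + c *: u) xc.
rewrite addrAC subrr add0r normrZ (ger0_norm c0) divfK ?gt_eqF//.
lra.
Qed.

Lemma barrier_strongly_convex x z s : X° x -> X° z -> 0 <= s <= 1 ->
  F (x + s *: (z - x)) <= (1 - s) * F x + s * F z
    - s * (1 - s) * ('D_(z - x) ('D_(z - x) F) xc / (nu + 2 * Num.sqrt nu) ^+ 2) / 2.
Proof.
move=> Xx Xz s01; set u := z - x; set k := (_ ^+ 2).
have k0 : 0 < k by rewrite exprn_gt0// ltr_pwDl// mulr_ge0// sqrtr_ge0.
have Xs r : 0 <= r <= 1 -> X° (x + r *: u).
  by move=> r01; apply: interior_segment_cc.
have := @strong_convexity_1d _ (fun s => F (x + s *: u))
  (fun s => 'D_u F (x + s *: u)) (fun s => 'D_u ('D_u F) (x + s *: u))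
  ('D_u ('D_u F) xc / k) s s01.
rewrite scale0r addr0 scale1r /u subrKC; apply => r /Xs Xr.
- exact/derive_barrier_line.
- exact/derive2_barrier_line.
- by rewrite ler_pdivrMr// mulrC; exact: barrier_hess_lower.
Qed.

End barrier.

(** * The accelerated gradient method *)

Section fast_gradient.
Variables (R : realType) (m : nat) (g : 'cV[R]_m -> R) (G : 'cV[R]_m -> 'cV[R]_m).
Variables (t c : R) (y v : nat -> 'cV[R]_m) (theta : nat -> R).
Hypotheses (t0 : 0 < t) (c0 : 0 < c).
Hypothesis run : fast_gradient_run G t c y v theta.

(** theta_{k+1} is the positive root of z^2 = (1 - z) theta_k^2, and 1 / theta_{k+1} >= 1 / theta_k
    + 1 / 2 gives the decay 2 / (k + 2). *)
Lemma theta_bounds k :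
  [/\ 0 < theta k, theta k <= 1 & theta k * k.+2%:R <= 2] /\
  theta k.+1 ^+ 2 = (1 - theta k.+1) * theta k ^+ 2.
Proof.
have step (th th' : R) : 0 < th -> th' = 2^-1 * th * (Num.sqrt (th ^+ 2 + 4) - th) ->
    [/\ 0 < th', th' ^+ 2 = (1 - th') * th ^+ 2 & th' * (2 + th) <= 2 * th].
  move=> th0 ->; set s := Num.sqrt _.
  have sE : s ^+ 2 = th ^+ 2 + 4 by rewrite sqr_sqrtr// addr_ge0// sqr_ge0.
  have s0 : 0 <= s by exact: sqrtr_ge0.
  have s2 : 2 <= s by rewrite -[2]ger0_norm// -sqrtr_sqr ler_wsqrtr//; nra.
  have sth : th < s by nra.
  split; first by rewrite !mulr_gt0// ?subr_gt0// invr_gt0.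
    have -> : (2^-1 * th * (s - th)) ^+ 2 = 4^-1 * th ^+ 2 * (s ^+ 2 - 2 * s * th + th ^+ 2).
      by field.
    by rewrite sE; field.
  have -> : 2^-1 * th * (s - th) * (2 + th) =
      th * (2^-1 * (s ^+ 2 - th ^+ 2) - 2^-1 * (s - th) * (s - 2)) by field.
  rewrite sE; have := mulr_ge0 (ltW th0) (mulr_ge0 (_ : 0 <= s - th) (_ : 0 <= s - 2)).
  by rewrite !subr_ge0 => /(_ (ltW sth) s2); nra.
have bnd j : [/\ 0 < theta j, theta j <= 1 & theta j * j.+2%:R <= 2].
  elim: j => [|j [th0 th1 thj]]; first by rewrite (fg_theta0 run) mul1r.
  have [th'0 thE th'th] := step _ _ th0 (fg_theta run j).
  split=> //; first by have := exprn_gt0 2 th0; have := sqr_ge0 (theta j.+1); nra.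
  have th2 : 0 < 2 + theta j by rewrite addr_gt0.
  rewrite -(ler_pM2r th2) mulrAC.
  have := ler_wpM2r (ler0n R j.+3) th'th; rewrite -(natr1 j.+2).
  by move: thj; set x : R := j.+2%:R; lra.
by split=> //; have [th0 _ _] := bnd k; have [] := step _ _ th0 (fg_theta run k).
Qed.

Let r k := (theta k)^-1 *: (v k - (1 - theta k) *: y k).

(** [r] evolves by plain gradient steps, which is why the potential measures its distance to the
    minimizer. *)
Lemma fast_gradient_rS k :
  r k.+1 = r k - (t / (2 * c ^+ 2 * theta k)) *: G (v k).
Proof.
have [[th0 _ _] _] := theta_bounds k.+1.
rewrite /r; have /= -> := fg_v run k.
rewrite [_ + theta _ *: _]addrC addrK scalerA mulVf ?gt_eqF// scale1r.
by [].
Qed.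

Variable ys : 'cV[R]_m.
Hypothesis g_convex : forall y z, g y + dotv (G y) (z - y) <= g z.
Hypothesis g_smooth : forall y z,
  g z <= g y + dotv (G y) (z - y) + c ^+ 2 / (2 * t) * norm2 (z - y) ^+ 2.
Hypothesis G_le : forall y, norm2 (G y) <= 2 * c.
Hypothesis ys_min : forall z, g ys <= g z.

Lemma fast_gradient_descent k :
  g (y k.+1) <= g (v k) - t / (4 * c ^+ 2) * norm2 (G (v k)) ^+ 2.
Proof.
apply: le_trans (g_smooth (v k) _) _.
have /= yE := fg_y run k.
have -> : y k.+1 - v k = - (t / (c * (c + norm2 (G (v k)))) *: G (v k)).
  by rewrite yE addrAC subrr add0r.
rewrite dotvNr dotvZr -norm2_sqr.
rewrite norm2N norm2Z exprMn real_normK ?num_real//.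
set l := norm2 _; have l0 : 0 <= l by exact: norm2_ge0.
have lc : l <= 2 * c by exact: G_le.
have cl : 0 < c + l by rewrite ltr_pwDl.
rewrite -addrA lerD2l -subr_ge0.
(* The surplus over the claimed decrease; its only factor of unclear sign, c^2 + l (2c - l), is
   positive as l <= 2c. *)
have -> : - (t / (4 * c ^+ 2) * l ^+ 2) - (- (t / (c * (c + l)) * l ^+ 2) +
  c ^+ 2 / (2 * t) * ((t / (c * (c + l))) ^+ 2 * l ^+ 2)) =
  t * l ^+ 2 * (c ^+ 2 + l * (2 * c - l)) / (4 * c ^+ 2 * (c + l) ^+ 2).
  by field; rewrite !gt_eqF.
apply: divr_ge0; last exact: mulr_ge0 (mulr_ge0 (ler0n _ 4) (sqr_ge0 _)) (sqr_ge0 _).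
apply: mulr_ge0; first exact: mulr_ge0 (ltW t0) (sqr_ge0 _).
by apply: addr_ge0; rewrite ?sqr_ge0// mulr_ge0// subr_ge0.
Qed.

(** As v^k is the combination of r^k and y^k with weights theta_k and 1 - theta_k, the tangent
    inequalities at v^k towards y* and y^k, with these weights, leave only the inner product of the
    gradient with r^k - y*. *)
Lemma fast_gradient_step k :
  g (y k.+1) - g ys <= (1 - theta k) * (g (y k) - g ys) +
    c ^+ 2 / t * theta k ^+ 2 * (norm2 (r k - ys) ^+ 2 - norm2 (r k.+1 - ys) ^+ 2).
Proof.
have [[th0 th1 _] _] := theta_bounds k.
have := fast_gradient_descent k.
have := g_convex (v k) (y k); have := g_convex (v k) ys.
rewrite fast_gradient_rS; set th := theta k in th0 th1 *; set p := G (v k).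
have vE : v k = th *: r k + (1 - th) *: y k.
  by rewrite /r scalerA divff ?gt_eqF// scale1r subrK.
set d := r k - ys; set rho := t / (2 * c ^+ 2 * th).
have -> : r k - rho *: p - ys = d - rho *: p by rewrite addrAC.
rewrite (norm2_subZ_sqr d p rho).
have -> : c ^+ 2 / t * th ^+ 2 * (norm2 d ^+ 2 -
    (norm2 d ^+ 2 - 2 * rho * dotv p d + rho ^+ 2 * norm2 p ^+ 2)) =
    th * dotv p d - t / (4 * c ^+ 2) * norm2 p ^+ 2.
  by rewrite /rho; field; rewrite !gt_eqF.
have dE (p' x z w : 'cV[R]_m) :
    (1 - th) * dotv p' (z - (th *: x + (1 - th) *: z)) +
    th * dotv p' (w - (th *: x + (1 - th) *: z)) = - (th * dotv p' (x - w)).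
  by rewrite !(dotvDr, dotvNr, dotvZr); ring.
have := dE p (r k) (y k) ys; rewrite -vE -/d => {}dE.
have th1' : 0 <= 1 - th by rewrite subr_ge0.
move=> /(ler_wpM2l (ltW th0)) cs /(ler_wpM2l th1') cy.
by set q := t / _ * _; lra.
Qed.

Lemma fast_gradient_rate k :
  g (y k) - g ys <= 4 * c ^+ 2 / (t * k.+1%:R ^+ 2) * norm2 (y 0%N - ys) ^+ 2.
Proof.
have gys z : 0 <= g z - g ys by rewrite subr_ge0.
(* At j = 0, theta_0 = 1 removes the term in y^0 and r^0 = y^0; later (1 - theta_{j+1}) theta_j^2 =
   theta_{j+1}^2 makes the sum telescope. *)
have energy j : g (y j.+1) - g ys <= c ^+ 2 / t * theta j ^+ 2 *
    (norm2 (y 0%N - ys) ^+ 2 - norm2 (r j.+1 - ys) ^+ 2).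
  elim: j => [|j IHj].
    have := fast_gradient_step 0.
    rewrite /r (fg_theta0 run) subrr mul0r add0r scale0r subr0 invr1 scale1r.
    by rewrite (fg_v0 run).
  have [[th0 th1 _] _] := theta_bounds j.+1.
  have [_ thE] := theta_bounds j.
  apply: le_trans (fast_gradient_step j.+1) _.
  have : 0 <= 1 - theta j.+1 by rewrite subr_ge0.
  move=> /(ler_wpM2l)/(_ _ _ IHj).
  set A := norm2 (y 0 - ys) ^+ 2; set B := norm2 (r j.+1 - ys) ^+ 2.
  set C := norm2 (r j.+2 - ys) ^+ 2.
  have -> : (1 - theta j.+1) * (c ^+ 2 / t * theta j ^+ 2 * (A - B)) =
     c ^+ 2 / t * theta j.+1 ^+ 2 * (A - B) by rewrite thE; ring.
  by set u := _ / _ * _; lra.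
(* The energy bound starts at y^1. At y^0 the quadratic upper bound at [ys], where the gradient
   vanishes, gives the constant c^2 / (2t). *)
case: k => [|k].
  have ct : 0 < t / c ^+ 2 by rewrite divr_gt0// exprn_gt0.
  have ys0 : G ys = 0.
    apply: dotv_eq0; apply/eqP; rewrite eq_le dotv_ge0 andbT.
    have := le_trans (ys_min _) (g_smooth ys (ys - (t / c ^+ 2) *: G ys)).
    rewrite (addrAC ys) subrr add0r norm2N norm2Z dotvNr dotvZr exprMn.
    rewrite real_normK ?num_real// norm2_sqr.
    have -> : c ^+ 2 / (2 * t) * ((t / c ^+ 2) ^+ 2 * dotv (G ys) (G ys)) =
      t / c ^+ 2 * dotv (G ys) (G ys) / 2 by field; rewrite !gt_eqF.
    by move=> H; rewrite -(pmulr_rle0 _ ct); lra.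
  have := g_smooth ys (y 0%N); rewrite ys0 dotv0l addr0 expr1n mulr1.
  have : c ^+ 2 / (2 * t) <= 4 * c ^+ 2 / t.
    have -> : c ^+ 2 / (2 * t) = c ^+ 2 / t / 2 by field; rewrite gt_eqF.
    have : 0 < c ^+ 2 / t by rewrite divr_gt0// exprn_gt0.
    by rewrite -mulrA; lra.
  by move=> /(ler_wpM2r (sqr_ge0 (norm2 (y 0%N - ys)))); lra.
have [[th0 th1 thk] _] := theta_bounds k.
apply: le_trans (energy k) _.
have n2 : 0 <= norm2 (y 0%N - ys) ^+ 2 by exact: sqr_ge0.
have k2 : 0 < k.+2%:R :> R by rewrite ltr0n.
have ct : 0 < c ^+ 2 / t by rewrite divr_gt0// exprn_gt0.
apply: (@le_trans _ _ (c ^+ 2 / t * theta k ^+ 2 * norm2 (y 0%N - ys) ^+ 2)).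
  apply: ler_wpM2l; first exact: mulr_ge0 (ltW ct) (sqr_ge0 _).
  by rewrite lerBlDr lerDl sqr_ge0.
rewrite ler_wpM2r//.
have -> : 4 * c ^+ 2 / (t * k.+2%:R ^+ 2) = c ^+ 2 / t * (2 / k.+2%:R) ^+ 2.
  by field; rewrite !gt_eqF.
rewrite ler_pM2l// ler_sqr ?nnegrE ?(ltW th0) ?divr_ge0//.
by rewrite ler_pdivlMr.
Qed.

End fast_gradient.

(** * Smoothing of the dual *)

Section smoothing.
Variables (R : realType) (m n : nat) (phi F : 'cV[R]_n -> R).
Variables (X : set 'cV[R]_n) (A : 'M[R]_(m, n)) (b : 'cV[R]_m) (t c : R).
(* [N2] is the square of a norm with respect to which [F] is 1-strongly convex
   and [A] is [c]-Lipschitz. *)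
Variable N2 : 'cV[R]_n -> R.
Implicit Types (x z u : 'cV[R]_n) (y w d : 'cV[R]_m) (e s : R).
Hypotheses (t0 : 0 < t) (c0 : 0 < c).
Hypothesis X0 : X° !=set0.
Hypothesis convX : forall x z s, X° x -> X° z -> 0 <= s <= 1 ->
  X° (x + s *: (z - x)).
Hypothesis concave_phi : forall x z s, 0 <= s <= 1 ->
  (1 - s) * phi x + s * phi z <= phi (x + s *: (z - x)).
Hypothesis strongly_convex_F : forall x z s, X° x -> X° z -> 0 <= s <= 1 ->
  F (x + s *: (z - x)) <= (1 - s) * F x + s * F z - s * (1 - s) * N2 (z - x) / 2.
Hypothesis A_lip : forall u, norm2 (A *m u) ^+ 2 <= c ^+ 2 * N2 u.
Hypothesis A_le : forall x, X° x -> norm2 (A *m x - b) <= 2 * c.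
Hypothesis phiF_le : exists B, forall x, X° x -> phi x - t * F x <= B.

Let g := smoothed_dual phi F X A b t.
Let h y x := phi x + dotv y (A *m x - b) - t * F x.

Lemma lagrangian_has_sup y : has_sup [set h y x | x in X°].
Proof.
split; first by case: X0 => x Xx; exists (h y x), x.
have [B phiB] := phiF_le; exists (B + norm2 y * (2 * c)) => _ [x Xx <-].
have := phiB x Xx; have := dotv_le_norm2 y (A *m x - b).
have := ler_wpM2l (norm2_ge0 y) (A_le Xx); rewrite /h; lra.
Qed.

Lemma lagrangian_le y x : X° x -> h y x <= g y.
Proof.
by move=> Xx; apply: (ub_le_sup (lagrangian_has_sup y).2); exists x.
Qed.

Lemma smoothed_dual_le y B : (forall x, X° x -> h y x <= B) -> g y <= B.
Proof.
move=> hB; apply: ge_sup (lagrangian_has_sup y).1 _ => _ [x Xx <-].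
exact: hB.
Qed.

Lemma smoothed_dual_approx y e : 0 < e -> exists2 x, X° x & g y - e < h y x.
Proof.
by move=> /sup_adherent/(_ (lagrangian_has_sup y))[_ [x Xx <-]]; exists x.
Qed.

(** Quadratic growth away from an e-maximizer, read off the Lagrangian at x + s (z - x). The factor
    s is kept free: 1/2 compares two near-maximizers, s -> 0 recovers the sharp constant. *)
Lemma lagrangian_gap y x z e s : X° x -> X° z -> g y - e <= h y x -> 0 < s <= 1 ->
  s * h y z + t * s * (1 - s) / 2 * N2 (z - x) <= s * g y + (1 - s) * e.
Proof.
move=> Xx Xz gx /andP[s0 s1]; have s01 : 0 <= s <= 1 by rewrite ltW.
have := lagrangian_le y (convX Xx Xz s01).
have := concave_phi x z s01.
have := ler_wpM2l (ltW t0) (strongly_convex_F Xx Xz s01).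
have s1' : 0 <= 1 - s by rewrite subr_ge0.
have := ler_wpM2l s1' gx; rewrite /h.
have -> : A *m (x + s *: (z - x)) - b =
    (1 - s) *: (A *m x - b) + s *: (A *m z - b).
  rewrite mulmxDr -scalemxAr mulmxBr; move: (A *m x) (A *m z) => p q.
  by apply/colP => i; rewrite !mxE; ring.
rewrite (dotvDr y ((1 - s) *: _)) !dotvZr; lra.
Qed.

Lemma lagrangian_argmax_close y x z e : X° x -> X° z ->
  g y - e <= h y x -> g y - e <= h y z ->
  norm2 (A *m z - A *m x) ^+ 2 <= 8 * c ^+ 2 * e / t.
Proof.
move=> Xx Xz gx gz.
have h2 : 0 < (2^-1 : R) <= 1 by apply/andP; split; lra.
have := lagrangian_gap Xx Xz gx h2; rewrite -mulmxBr => gap.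
apply: le_trans (A_lip _) _; rewrite ler_pdivlMr//.
have : t * N2 (z - x) <= 8 * e by lra.
by move=> /(ler_wpM2l (sqr_ge0 c)); lra.
Qed.

(** Eventual lower bounds: the supremum is the lower limit of the coordinate over e-maximizers as e
    tends to 0. *)
Definition gradient_slice y (i : 'I_m) : set R :=
  [set a | exists2 e, 0 < e & forall x, X° x -> g y - e <= h y x ->
    a <= (A *m x - b) i 0].

(* The limit of [A x - b] along maximizing families of the Lagrangian; no
   maximizer is needed. *)
Definition dual_gradient y : 'cV[R]_m := \col_i sup (gradient_slice y i).

Lemma coord_le_norm2 w (i : 'I_m) : `|w i 0| <= norm2 w.
Proof.
rewrite -ler_sqr ?nnegrE ?norm2_ge0// norm2_sqr real_normK ?num_real// dotvE.
rewrite (bigD1 i)//= -expr2 lerDl sumr_ge0// => j _.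
by rewrite -expr2 sqr_ge0.
Qed.

Lemma dual_gradient_coord y x e i : 0 < e -> X° x -> g y - e <= h y x ->
  `|(A *m x - b - dual_gradient y) i 0| <= Num.sqrt (8 * c ^+ 2 * e / t).
Proof.
move=> e0 Xx gx; set dl := Num.sqrt _.
have close z : X° z -> g y - e <= h y z ->
    `|(A *m z - b) i 0 - (A *m x - b) i 0| <= dl.
  move=> Xz gz; have -> : (A *m z - b) i 0 - (A *m x - b) i 0 = (A *m z - A *m x) i 0.
    by rewrite !mxE; ring.
  apply: le_trans (coord_le_norm2 _ _) _.
  rewrite -[leLHS]ger0_norm ?norm2_ge0// -sqrtr_sqr ler_wsqrtr//.
  exact: lagrangian_argmax_close gx gz.
have Sx : gradient_slice y i ((A *m x - b) i 0 - dl).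
  exists e => // z Xz gz; have := close z Xz gz.
  by rewrite ler_distl => /andP[].
have ubS : ubound (gradient_slice y i) ((A *m x - b) i 0 + dl).
  move=> a [e' e'0 aP].
  have ee0 : 0 < Num.min e e' by rewrite lt_min e0.
  (* A point maximizing to both accuracies links the bound [a] to [x]. *)
  have [z Xz gz] := smoothed_dual_approx y ee0.
  have gze : g y - e <= h y z.
    by apply: le_trans (ltW gz); rewrite lerB// ge_min lexx.
  have gze' : g y - e' <= h y z.
    by apply: le_trans (ltW gz); rewrite lerB// ge_min lexx orbT.
  apply: le_trans (aP z Xz gze') _; have := close z Xz gze.
  by rewrite ler_distl => /andP[].
have -> : (A *m x - b - dual_gradient y) i 0 =
    (A *m x - b) i 0 - sup (gradient_slice y i) by rewrite !mxE.
have lo : (A *m x - b) i 0 - dl <= sup (gradient_slice y i).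
  by apply: ub_le_sup Sx; exists ((A *m x - b) i 0 + dl).
have hi : sup (gradient_slice y i) <= (A *m x - b) i 0 + dl.
  by apply: ge_sup ubS; exists ((A *m x - b) i 0 - dl).
rewrite ler_norml; apply/andP; split; lra.
Qed.

Lemma dual_gradient_approx y e : 0 < e -> exists x,
  [/\ X° x, g y - e <= h y x & norm2 (A *m x - b - dual_gradient y) <= e].
Proof.
(* The sum of the [m] squared coordinate bounds is at most K e'; [m.+1] keeps K positive for every
   [m]. *)
move=> e0; pose K := 8 * c ^+ 2 * m.+1%:R / t.
have K0 : 0 < K by rewrite divr_gt0// !mulr_gt0// exprn_gt0.
pose e' := Num.min e (e ^+ 2 / K).
have e'0 : 0 < e' by rewrite lt_min e0 divr_gt0// exprn_gt0.
have [x Xx gx] := smoothed_dual_approx y e'0.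
exists x; split=> //.
  by apply: le_trans (ltW gx); rewrite lerB// ge_min lexx.
rewrite -ler_sqr ?nnegrE ?norm2_ge0 ?(ltW e0)// norm2_sqr dotvE.
have co i := dual_gradient_coord i e'0 Xx (ltW gx).
have r0 : 0 <= 8 * c ^+ 2 * e' / t.
  by rewrite divr_ge0 ?(ltW t0)// !mulr_ge0 ?(ltW c0) ?(ltW e'0).
apply: (@le_trans _ _ (\sum_(i < m) 8 * c ^+ 2 * e' / t)).
  apply: ler_sum => i _; rewrite -expr2 -real_normK ?num_real//.
  rewrite -[leRHS]sqr_sqrtr// ler_sqr ?nnegrE ?sqrtr_ge0//; exact: co.
rewrite sumr_const card_ord -[_ *+ m]mulr_natr.
apply: (@le_trans _ _ (K * e')).
  have -> : K * e' = 8 * c ^+ 2 * e' / t * m.+1%:R.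
    by rewrite /K; field; rewrite gt_eqF.
  by rewrite ler_wpM2l// ler_nat.
by rewrite mulrC -ler_pdivlMr// ge_min lexx orbT.
Qed.

Lemma smoothed_dual_subgradient y w : g y + dotv (dual_gradient y) (w - y) <= g w.
Proof.
apply/ler_addgt0Pr => e e0; set d := w - y; set p := dual_gradient y.
have d1 : 0 < 1 + norm2 d by rewrite ltr_pwDl// norm2_ge0.
have [x [Xx gx px]] := dual_gradient_approx y (divr_gt0 e0 d1).
have := lagrangian_le w Xx.
have -> : h w x = h y x + dotv d (A *m x - b).
  by rewrite /h /d dotvDl dotvNl; ring.
have : dotv d p = dotv d (A *m x - b) - dotv d (A *m x - b - p).
  by rewrite -dotvNr -dotvDr subKr.
rewrite (dotvC p) => ->.
have := dotv_le_norm2 (- d) (A *m x - b - p); rewrite norm2N dotvNl.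
have := ler_wpM2l (norm2_ge0 d) px.
have : e = e / (1 + norm2 d) * (1 + norm2 d) by rewrite divfK// gt_eqF.
move: gx; set q := e / _; set l := norm2 d; lra.
Qed.

(** Passing from [y] to [w] adds <w - y, A z - b> to the Lagrangian; its variation between a
    near-maximizer [x] and [z] is absorbed by the quadratic growth term. *)
Lemma smoothed_dual_upper y w : g w <= g y + dotv (dual_gradient y) (w - y) +
  c ^+ 2 / (2 * t) * norm2 (w - y) ^+ 2.
Proof.
set d := w - y; set p := dual_gradient y; set K := _ * norm2 d ^+ 2.
have K0 : 0 <= K.
  apply: mulr_ge0 (sqr_ge0 _); rewrite divr_ge0 ?sqr_ge0// mulr_ge0// ltW//.
have step s : 0 < s < 1 -> g w <= g y + dotv p d + K / (1 - s).
  move=> /andP[s0 s1]; have s1' : 0 < 1 - s by rewrite subr_gt0.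
  apply/ler_addgt0Pr => e e0.
  (* An accuracy q costs (1/s - 1) q in the growth inequality and |d| q in the gradient. *)
  have d1 : 0 < s^-1 + norm2 d by rewrite ltr_pwDl ?norm2_ge0// invr_gt0.
  have [x [Xx gx px]] := dual_gradient_approx y (divr_gt0 e0 d1).
  move: gx px; set q := e / _ => gx px.
  have q0 : 0 < q by exact: divr_gt0.
  have qe : e = q * (s^-1 + norm2 d) by rewrite divfK// gt_eqF.
  apply: smoothed_dual_le => z Xz.
  have -> : h w z = h y z + dotv d (A *m z - b).
    by rewrite /h /d dotvDl dotvNl; ring.
  have ss1 : 0 < s <= 1 by rewrite s0 ltW.
  have := lagrangian_gap Xx Xz gx ss1.
  set N := N2 (z - x) => gap.
  have gap' : h y z <= g y + (s^-1 - 1) * q - t * (1 - s) / 2 * N.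
    rewrite -(ler_pM2l s0); apply: le_trans (_ : s * g y + (1 - s) * q -
      t * s * (1 - s) / 2 * N <= _); first by lra.
    by rewrite le_eqVlt; apply/orP; left; apply/eqP; field; rewrite gt_eqF.
  have dE : dotv d (A *m z - b) = dotv d p + dotv d (A *m x - b - p) +
      dotv d (A *m (z - x)).
    rewrite -!dotvDr mulmxBr; congr dotv; move: (A *m z) (A *m x) => a1 a2.
    by apply/colP => i; rewrite !mxE; ring.
  have d1' := le_trans (dotv_le_norm2 d (A *m x - b - p))
    (ler_wpM2l (norm2_ge0 d) px).
  have d2 : dotv d (A *m (z - x)) <= t * (1 - s) / 2 * N + K / (1 - s).
    apply: le_trans (dotv_le_norm2 _ _) _.
    have := A_lip (z - x); rewrite -/N /K.
    set a := norm2 (A *m _); set l := norm2 d => aN.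
    have tau0 : 0 < t * (1 - s) by exact: mulr_gt0.
    have c20 : 0 < c ^+ 2 by exact: exprn_gt0.
    (* Young: [l a <= tau a^2 / (2 c^2) + c^2 l^2 / (2 tau)] for
       [tau = t (1 - s)] *)
    have : 0 <= (t * (1 - s) * a - c ^+ 2 * l) ^+ 2 / (2 * (t * (1 - s)) * c ^+ 2).
      by rewrite divr_ge0 ?sqr_ge0// mulr_ge0 ?(ltW c20)// mulr_ge0// ltW.
    have -> : (t * (1 - s) * a - c ^+ 2 * l) ^+ 2 / (2 * (t * (1 - s)) * c ^+ 2) =
      t * (1 - s) / 2 / c ^+ 2 * a ^+ 2 - l * a +
      c ^+ 2 / (2 * t) * l ^+ 2 / (1 - s) by field; rewrite !gt_eqF.
    have : t * (1 - s) / 2 / c ^+ 2 * a ^+ 2 <= t * (1 - s) / 2 * N.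
      by rewrite -[in leLHS]mulrA ler_pM2l ?divr_gt0// ler_pdivrMl.
    by lra.
  move: gap' d1' d2; rewrite dE qe (dotvC p d); lra.
have [|gap] := leP (g w) (g y + dotv p d + K); first by [].
pose D := g w - g y - dotv p d.
have KD : K < D by rewrite /D; lra.
have D0 : 0 < D by exact: le_lt_trans KD.
(* For this s, K / (1 - s) = 2DK / (D + K), which is less than D since K < D. *)
have s01 : 0 < (D - K) / (2 * D) < 1.
  apply/andP; split; first by rewrite divr_gt0 ?mulr_gt0// subr_gt0.
  by rewrite ltr_pdivrMr ?mulr_gt0//; lra.
have := step _ s01.
have E : 1 - (D - K) / (2 * D) = (D + K) / (2 * D) by field; rewrite gt_eqF.
have DK : 0 < D + K by exact: ltr_pwDl.
have : D <= K / (1 - (D - K) / (2 * D)) -> False.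
  rewrite E ler_pdivlMr ?divr_gt0 ?mulr_gt0//.
  have -> : D * ((D + K) / (2 * D)) = (D + K) / 2 by field; rewrite gt_eqF.
  by lra.
by move=> nD H; exfalso; apply: nD; rewrite {1}/D; lra.
Qed.

(** The remainder g(w) - g(y) - <p, w - y> lies between 0 and a multiple of |w - y|^2, so the
    candidate p is the gradient. *)
Lemma grad_smoothed_dual y : grad g y = dual_gradient y.
Proof.
apply/colP => i; rewrite mxE; set d := delta_mx i 0.
suff [] : is_derive y d g (dual_gradient y i 0) by [].
pose K := c ^+ 2 / (2 * t).
have K0 : 0 < K by rewrite divr_gt0 ?mulr_gt0 ?exprn_gt0.
apply/is_deriveP => e e0; exists (e / K); first exact: divr_gt0.
move=> r r0 rK.
have pd : dotv (dual_gradient y) d = dual_gradient y i 0.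
  rewrite dotvE (bigD1 i)//= big1 => [|j ji]; first by rewrite [d _ _]mxE !eqxx mulr1 addr0.
  by rewrite [d _ _]mxE (negPf ji) mulr0.
have dd : norm2 d ^+ 2 = 1.
  rewrite norm2_sqr dotvE (bigD1 i)//= big1 => [|j ji].
    by rewrite [d _ _]mxE !eqxx mulr1 addr0.
  by rewrite [d _ _]mxE (negPf ji) mulr0.
have := smoothed_dual_upper y (y + r *: d).
have := smoothed_dual_subgradient y (y + r *: d).
rewrite (addrAC y) subrr add0r dotvZr pd norm2Z exprMn dd mulr1 -/K.
have : K * `|r| ^+ 2 <= e * `|r|.
  by rewrite expr2 mulrA ler_wpM2r// mulrC -ler_pdivlMr// ltW.
by rewrite ler_norml => *; apply/andP; split; lra.
Qed.

Lemma norm2_dual_gradient y : norm2 (dual_gradient y) <= 2 * c.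
Proof.
apply/ler_addgt0Pr => e e0; have [x [Xx _ px]] := dual_gradient_approx y e0.
rewrite -[dual_gradient y](subKr (A *m x - b)).
apply: le_trans (norm2D _ _) _; rewrite norm2N.
exact: lerD (A_le Xx) px.
Qed.

End smoothing.

(** * Product sets and separable functions *)

Section product.
Variables (R : realType) (N : nat) (n : 'I_N -> nat).
Implicit Types (x z u v : 'cV[R]_(\sum_i n i)).

Lemma submxcolZ a x i : submxcol (a *: x) i = a *: submxcol x i.
Proof. by apply/matrixP => k l; rewrite !mxE. Qed.

Lemma submxcol_line x u s i :
  submxcol (x + s *: u) i = submxcol x i + s *: submxcol u i.
Proof. by rewrite submxcolD submxcolZ. Qed.

Lemma near_submxcol x i (P : set 'cV[R]_(n i)) :
  nbhs (submxcol x i) P -> \forall z \near x, P (submxcol z i).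
Proof.
move=> /nbhs_ballP[e /= e0 eP]; apply/nbhs_ballP; exists e => //= z [_ xz].
by apply: eP; split=> // k l; rewrite !mxE; exact: xz.
Qed.

Lemma interior_prod_set (X : forall i, set 'cV[R]_(n i)) x :
  (prod_set X)° x <-> forall i, (X i)° (submxcol x i).
Proof.
split=> [/nbhs_ballP[e /= e0 eP] i|Xx].
  apply/(@nbhs_ballP _ _ _ (X i)); exists e => //= w [_ xw].
  (* [x] with block [i] replaced by [w]: as close to [x] as [w] is to that block. *)
  pose z := \mxcol_j dfwith (fun j => submxcol x j) i w j.
  have : prod_set X z.
    apply: eP; split=> // k l.
    have -> : x k l = submxcol x (tagnat.sig1 k) (tagnat.sig2 k) l.
      by rewrite -{1}(submxcolK x) mxE.
    rewrite [z k l]mxE; move: (tagnat.sig1 k) (tagnat.sig2 k) => j k'.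
    by case: dfwithP k' => [|{}j _] k'; [exact: xw|exact: ballxx].
  by move=> /(_ i); rewrite mxcolK dfwithin.
have : \forall z \near x, forall i, X i (submxcol z i).
  apply: (@filter_forall _ _ (fun i z => X i (submxcol z i)) (nbhs x)) => i.
  exact: near_submxcol (Xx i).
exact.
Qed.

Lemma is_derive_submxcol i (f : 'cV[R]_(n i) -> R) x u d :
  is_derive (submxcol x i) (submxcol u i) f d ->
  is_derive x u (fun z => f (submxcol z i)) d.
Proof.
move=> /is_deriveP H; apply/is_deriveP => e /H[dl dl0 {}H]; exists dl => // h.
by rewrite submxcol_line; exact: H.
Qed.

Lemma is_derive_sep_sum (f : forall i, 'cV[R]_(n i) -> R) x u (d : 'I_N -> R) :
  (forall i, is_derive (submxcol x i) (submxcol u i) (f i) (d i)) ->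
  is_derive x u (sep_sum f) (\sum_i d i).
Proof.
move=> df; have -> : sep_sum f = \sum_i (fun z => f i (submxcol z i)).
  by apply/funext => z; rewrite fct_sumE.
by apply: is_derive_sum => i; exact: is_derive_submxcol.
Qed.

Lemma derive2_sep_sum (X : forall i, set 'cV[R]_(n i))
    (F : forall i, 'cV[R]_(n i) -> R) x u v :
  (forall i, class_C 2 (X i)° (F i)) -> (prod_set X)° x ->
  'D_v ('D_u (sep_sum F)) x = \sum_i
    dotv (submxcol u i) (hessian (F i) (submxcol x i) *m submxcol v i).
Proof.
move=> C2F Xx; have /interior_prod_set Xi := Xx.
pose DF i := 'D_(submxcol u i) (F i).
have D1 z : (prod_set X)° z -> 'D_u (sep_sum F) z = sep_sum DF z.
  move=> /interior_prod_set Xz.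
  have [|_ ->] := @is_derive_sep_sum F z u (fun i => DF i (submxcol z i)).
    move=> i; apply/derivableP.
    have [_ C1] := C2F i.
    by case: (C1 (submxcol u i)) => + _; exact.
  by [].
(* The first derivative is known on the interior only, so it is replaced locally before being
   differentiated again. *)
have near1 : \near x, 'D_u (sep_sum F) x = sep_sum DF x.
  exact: (@open_near _ _ _ (open_interior (prod_set X))
    (fun z => 'D_u (sep_sum F) z = sep_sum DF z) x D1 Xx).
rewrite (near_eq_derive _ near1).
have [|_ ->] := @is_derive_sep_sum DF x v
  (fun i => 'D_(submxcol v i) (DF i) (submxcol x i)).
  move=> i; apply/derivableP; have [_ C1] := C2F i.
  by case: (C1 (submxcol u i)) => _ [_ C0]; case: (C0 (submxcol v i)) => + _; exact.
apply: eq_bigr => i _.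
by rewrite (hessianE (open_interior (X i)) (C2F i)).
Qed.

End product.

Lemma linear_form_delta (R : realType) n (f : 'cV[R]_n -> R) u :
  {morph f : x y / x + y} -> (forall a x, f (a *: x) = a * f x) ->
  f u = \sum_k u k 0 * f (delta_mx k 0).
Proof.
move=> fD fZ; have f0 : f 0 = 0 by rewrite -(scale0r 0) fZ mul0r.
rewrite {1}(matrix_sum_delta u); under eq_bigr do rewrite big_ord1.
rewrite (big_morph f fD f0); apply: eq_bigr => k _; exact: fZ.
Qed.

Lemma trmx_of_dotv (R : realType) n (H : 'M[R]_n) :
  (forall u w, dotv u (H *m w) = dotv w (H *m u)) -> H^T = H.
Proof.
have E k l : H k l = dotv (delta_mx k 0) (H *m delta_mx l 0).
  rewrite dotvE (bigD1 k)//= big1 => [|j jk]; last first.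
    by rewrite mxE (negPf jk) mul0r.
  rewrite mxE !eqxx mul1r addr0 mxE (bigD1 l)//= big1 => [|j jl].
    by rewrite mxE !eqxx mulr1 addr0.
  by rewrite mxE (negPf jl) mulr0.
by move=> sym; apply/matrixP => k l; rewrite mxE E sym -E.
Qed.

(** * The local norm of A as a Lipschitz constant *)

Section local_norm.
Variables (R : realType) (m n : nat) (F : 'cV[R]_n -> R) (A : 'M[R]_(m, n)).
Variable x : 'cV[R]_n.
Let H := hessian F x.
Hypothesis symH : H^T = H.
Hypothesis pdH : forall w, w != 0 -> 0 < dotv w (H *m w).

Let psdH w : 0 <= dotv w (H *m w).
Proof.
have [->|/pdH/ltW//] := eqVneq w 0; by rewrite dotv0l.
Qed.

Lemma local_norm_sqr :
  local_norm F A x ^+ 2 = spectral_norm (A *m invmx H *m A^T).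
Proof. by rewrite sqr_sqrtr// spectral_norm_ge0. Qed.

(** With w = A u and q = H^-1 A^T w, |w|^2 = <q, H u>; Cauchy-Schwarz for H applies, and <q, H q> is
    the quadratic form of A H^-1 A^T at w. *)
Lemma norm2_mulmx_local_norm u :
  norm2 (A *m u) ^+ 2 <= local_norm F A x ^+ 2 * dotv u (H *m u).
Proof.
rewrite local_norm_sqr; set w := A *m u; set sp := spectral_norm _.
have [p0|p_neq0] := eqVneq (A^T *m w) 0.
  rewrite norm2_sqr {2}/w dotv_mulmxr p0 dotv0l mulr_ge0//.
  exact: spectral_norm_ge0.
have [uH _] := quad_invmx_gt0 symH pdH p_neq0.
pose q := invmx H *m (A^T *m w).
have Hq : H *m q = A^T *m w by rewrite mulKVmx.
have ww : dotv w w = dotv q (H *m u).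
  by rewrite {2}/w dotv_mulmxr -Hq [in RHS]dotv_mulmxr symH.
have qq : dotv q (H *m q) <= sp * dotv w w.
  rewrite Hq dotvC -dotv_mulmxr.
  have := ler_dotv_spectral_norm (A *m invmx H *m A^T) w.
  by rewrite -/sp -(mulmxA _ A^T) -(mulmxA A).
have := cauchy_schwarz q u symH psdH; rewrite -ww norm2_sqr => cs.
have [->|w0] := eqVneq (dotv w w) 0.
  by rewrite mulr_ge0// spectral_norm_ge0.
have ww0 : 0 < dotv w w by rewrite lt0r w0 dotv_ge0.
rewrite -(ler_pM2r ww0) -expr2; apply: le_trans cs _.
by rewrite mulrAC ler_wpM2r.
Qed.

Lemma local_norm_gt0 : (0 < m)%N -> row_free A -> 0 < local_norm F A x.
Proof.
move=> m0 freeA; have [w w0] : exists w : 'cV[R]_m, w != 0.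
  exists (delta_mx (Ordinal m0) 0); apply/negP => /eqP/matrixP/(_ (Ordinal m0) 0).
  by rewrite !mxE !eqxx => /eqP; rewrite oner_eq0.
have Aw : A^T *m w != 0.
  by rewrite -trmx_eq0 trmx_mul trmxK mulmx_free_eq0// trmx_eq0.
have [_ q0] := quad_invmx_gt0 symH pdH Aw.
rewrite sqrtr_gt0 -(pmulr_lgt0 _ (_ : 0 < dotv w w)); last first.
  by rewrite -norm2_sqr exprn_gt0// norm2_gt0.
apply: lt_le_trans (ler_dotv_spectral_norm _ _).
by rewrite -!mulmxA dotv_mulmxr.
Qed.

End local_norm.

(** The matrix is defined by its entries, derivatives along basis vectors; bilinearity of the
    blockwise form extends the identity to all directions. *)
Lemma hessian_sep_sum (R : realType) (N : nat) (n : 'I_N -> nat)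
    (X : forall i, set 'cV[R]_(n i)) (F : forall i, 'cV[R]_(n i) -> R) x u w :
  (forall i, class_C 2 (X i)° (F i)) -> (prod_set X)° x ->
  dotv u (hessian (sep_sum F) x *m w) =
  \sum_i dotv (submxcol u i) (hessian (F i) (submxcol x i) *m submxcol w i).
Proof.
move=> C2F Xx; pose B u w :=
  \sum_i dotv (submxcol u i) (hessian (F i) (submxcol x i) *m submxcol w i).
have B1 w' u' : B u' w' = \sum_k u' k 0 * B (delta_mx k 0) w'.
  apply: (linear_form_delta (f := B ^~ w')) => [y z|a y]; rewrite /B.
    by rewrite -big_split; apply: eq_bigr => i _; rewrite submxcolD dotvDl.
  by rewrite mulr_sumr; apply: eq_bigr => i _; rewrite submxcolZ dotvZl.
have B2 u' w' : B u' w' = \sum_k w' k 0 * B u' (delta_mx k 0).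
  apply: (linear_form_delta (f := B u')) => [y z|a y]; rewrite /B.
    rewrite -big_split; apply: eq_bigr => i _.
    by rewrite submxcolD mulmxDr dotvDr.
  rewrite mulr_sumr; apply: eq_bigr => i _.
  by rewrite submxcolZ -scalemxAr dotvZr.
rewrite -/(B u w) dotvE B1; apply: eq_bigr => k _; congr (_ * _).
rewrite mxE B2; apply: eq_bigr => l _.
by rewrite mxE (derive2_sep_sum _ _ C2F Xx) mulrC.
Qed.

(** * Concavity and boundedness of the objective *)

Lemma concave_functionP (R : realType) n (f : 'cV[R]_n -> R) x z s :
  concave_function f -> 0 <= s <= 1 ->
  (1 - s) * f x + s * f z <= f (x + s *: (z - x)).
Proof.
move=> cf /andP[s0 s1].
have := cf (Itv01 s0 s1) z x; rewrite !inE => /(_ I I) H.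
have : - f (s *: z + (1 - s) *: x) <= s * - f z + (1 - s) * - f x := H.
have -> : s *: z + (1 - s) *: x = x + s *: (z - x).
  by rewrite scalerBr scalerBl scale1r addrCA.
lra.
Qed.

Lemma near_trmx (R : realType) n (v : 'rV[R]_n) (P : set 'cV[R]_n) :
  nbhs v^T P -> \forall w \near v, P w^T.
Proof.
move=> /nbhs_ballP[e /= e0 eP]; apply/nbhs_ballP; exists e => //= w [_ vw].
by apply: eP; split=> // i j; rewrite !mxE; exact: vw.
Qed.

(** Near each v, f is below f v + 1, and compactness makes the bound uniform. The argument runs on
    rows because [bounded_closed_compact] is applied there. *)
Lemma usc_bounded_above (R : realType) n (X : set 'cV[R]_n) (f : 'cV[R]_n -> R) :
  closed X -> bounded_set X -> upper_semicontinuous (fun x => (f x)%:E) ->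
  exists B, forall x, X x -> f x <= B.
Proof.
move=> clX bdX uscf; pose K := [set v : 'rV[R]_n | X v^T].
have clK : closed K.
  move=> v clv; apply: clX => P /near_trmx /clv[w [Kw Pw]].
  by exists w^T.
have bdK : bounded_set K.
  case: bdX => M [Mr XM]; exists M; split=> // M' MM' v Kv.
  apply/ler_addgt0Pr => e e0.
  have /le_lt_trans/(_ (_ : M' < M' + e)) := XM M' MM' _ Kv.
  rewrite ltrDl => /(_ e0) ve.
  have : ball (0 : 'cV[R]_n) (M' + e) v^T by rewrite -ball_normE /= sub0r normrN.
  move=> [Me vb]; suff : ball (0 : 'rV[R]_n) (M' + e) v.
    by rewrite -ball_normE /= sub0r normrN => /ltW.
  by split=> // i j; have := vb j i; rewrite !mxE.
have /compact_near_coveringP cK := bounded_closed_compact bdK clK.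
suff : \forall B \near +oo, K `<=` (fun v => f v^T <= B).
  move=> /filter_ex[B KB]; exists B => x Xx.
  by have := KB x^T; rewrite /K/= trmxK; exact.
apply: cK => v Kv; have [|V nV fV] := uscf v^T (- f v^T - 1).
  by rewrite -EFinN lte_fin; lra.
exists ([set w | V w^T], [set B | f v^T + 1 < B]) => /=.
  by split; [exact: near_trmx|exact: nbhs_pinfty_gt (num_real _)].
by move=> [w B] [/= /fV + fB]; rewrite -EFinN lte_fin; lra.
Qed.

Lemma inf_range_argmin (R : realType) (T : Type) (f : T -> R) x :
  is_argmin [set: T] f x -> inf (range f) = f x.
Proof.
move=> [_ fx]; have lb : lbound (range f) (f x) by move=> _ [z _ <-]; exact: fx.
apply/eqP; rewrite eq_le lb_le_inf ?andbT//; last by exists (f x), x.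
by apply: ge_inf; [exists (f x)|exists x].
Qed.

(** * The barrier of a product and its norm at the analytic center *)

Section separable_barrier.
Variables (R : realType) (N : nat) (n : 'I_N -> nat).
Variables (X : forall i : 'I_N, set 'cV[R]_(n i)) (nu : 'I_N -> R).
Variables (F : forall i : 'I_N, 'cV[R]_(n i) -> R).
Variable (xc : forall i : 'I_N, 'cV[R]_(n i)).
Arguments X : clear implicits.
Arguments F : clear implicits.
Arguments xc : clear implicits.
Implicit Types (x z u : 'cV[R]_(\sum_i n i)) (s : R).
Hypothesis N0 : (0 < N)%N.
Hypothesis convX : forall i, convex_set (X i : set (convex_lmodType 'cV[R]_(n i))).
Hypothesis bndX : forall i, bounded_set (X i).
Hypothesis nu0 : forall i, 0 < nu i.
Hypothesis barF : forall i, self_concordant_barrier (X i) (nu i) (F i).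
Hypothesis xcmin : forall i, is_argmin (X i)° (F i) (xc i).

Let H := hessian (sep_sum F) (\mxcol_i xc i).
Let kap i := nu i + 2 * Num.sqrt (nu i).

(* The squared local norm at the analytic center, scaled so that [prod_set X]
   lies in the unit ball around it. *)
Definition center_norm2 u : R := dotv u (H *m u) / kappa nu ^+ 2.

Let kap_gt0 i : 0 < kap i.
Proof. by rewrite ltr_pwDl// mulr_ge0// sqrtr_ge0. Qed.

Let kap_le i : kap i <= kappa nu.
Proof.
rewrite /kappa (bigD1 i)//= lerDl sumr_ge0// => j _.
by rewrite ltW// kap_gt0.
Qed.

Lemma kappa_gt0 : 0 < kappa nu.
Proof. by apply: lt_le_trans (kap_le (Ordinal N0)); exact: kap_gt0. Qed.

Let sum_kap_sqr : \sum_i kap i ^+ 2 <= kappa nu ^+ 2.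
Proof.
rewrite [leRHS]expr2 {1}/kappa mulr_suml; apply: ler_sum => i _.
by rewrite expr2 ler_pM2l// kap_gt0.
Qed.

Lemma center_interior : (prod_set X)° (\mxcol_i xc i).
Proof.
by apply/interior_prod_set => i; rewrite mxcolK; case: (xcmin i).
Qed.

Lemma separable_C2 i : class_C 2 (X i)° (F i).
Proof. exact: barrier_C2 (barF i). Qed.

Let Q i (d : 'cV[R]_(n i)) := 'D_d ('D_d (F i)) (xc i).
Arguments Q : clear implicits.

Lemma separable_hessianE u : dotv u (H *m u) = \sum_i Q i (submxcol u i).
Proof.
rewrite (hessian_sep_sum _ _ separable_C2 center_interior).
apply: eq_bigr => i _; rewrite mxcolK.
exact: (hessianE (open_interior (X i)) (@separable_C2 i) _ _ (xcmin i).1).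
Qed.

Let Q_ge0 i d : 0 <= Q i d.
Proof. by apply: (barrier_hess_ge0 (barF i)); case: (xcmin i). Qed.

Lemma separable_hessian_sym : H^T = H.
Proof.
apply: trmx_of_dotv => u w.
rewrite !(hessian_sep_sum _ _ separable_C2 center_interior).
apply: eq_bigr => i _; rewrite mxcolK.
have Xc := (xcmin i).1; have oX := open_interior (X i).
rewrite (hessianE oX (@separable_C2 i) _ _ Xc).
rewrite (hessianE oX (@separable_C2 i) _ _ Xc).
by apply: (class_C_sym oX (@separable_C2 i)); exact: Xc.
Qed.

Lemma separable_hessian_gt0 w : w != 0 -> 0 < dotv w (H *m w).
Proof.
move=> w0; have [i wi] : exists i, submxcol w i != 0.
  apply/existsP; apply: contraT => /existsPn wi; case/eqP: w0.
  by apply/mxcolP => i; rewrite submxcol0; apply/eqP; rewrite -[_ == _]negbK wi.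
rewrite separable_hessianE (bigD1 i)//= ltr_pwDl//.
  by apply: (barrier_hess_gt0 (barF i) (xcmin i)) => //; exact: bndX.
by apply: sumr_ge0 => j _; exact: Q_ge0.
Qed.

Lemma prod_set_segment x z s : (prod_set X)° x -> (prod_set X)° z ->
  0 <= s <= 1 -> (prod_set X)° (x + s *: (z - x)).
Proof.
move=> /interior_prod_set Xx /interior_prod_set Xz s01.
apply/interior_prod_set => i; rewrite submxcol_line submxcolB.
exact: interior_segment_cc.
Qed.

Lemma separable_strongly_convex x z s :
  (prod_set X)° x -> (prod_set X)° z -> 0 <= s <= 1 ->
  sep_sum F (x + s *: (z - x)) <= (1 - s) * sep_sum F x + s * sep_sum F z
    - s * (1 - s) * center_norm2 (z - x) / 2.
Proof.
move=> /interior_prod_set Xx /interior_prod_set Xz s01.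
have k0 := kappa_gt0.
rewrite /center_norm2 separable_hessianE /sep_sum.
rewrite mulr_suml !mulr_sumr mulr_suml -big_split/= -sumrB.
apply: ler_sum => i _; rewrite submxcol_line submxcolB.
have := barrier_strongly_convex (@convX i) (nu0 i) (barF i) (xcmin i)
  (Xx i) (Xz i) s01.
rewrite -/(Q i _) -/(kap i) => /le_trans; apply.
rewrite lerD2l lerN2 ler_pM2r// ler_wpM2l//.
  by case/andP: s01 => s0 s1; rewrite mulr_ge0// subr_ge0.
(* Each block has its own modulus 1 / kap_i^2; the common 1 / kappa^2 is smaller. *)
rewrite ler_wpM2l// lef_pV2 ?posrE ?exprn_gt0//.
by rewrite ler_sqr ?nnegrE ?(ltW (kap_gt0 _)) ?(ltW k0).
Qed.

(** In each block the parallelogram identity at the center gives 4 kap_i^2, and the sum of the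
    kap_i^2 is at most kappa^2. *)
Lemma center_norm2_diff x z : prod_set X x -> prod_set X z ->
  center_norm2 (x - z) <= 4.
Proof.
move=> Xx Xz; rewrite ler_pdivrMr ?exprn_gt0 ?kappa_gt0//.
rewrite separable_hessianE.
apply: (@le_trans _ _ (\sum_i 4 * kap i ^+ 2)); last first.
  by rewrite -mulr_sumr ler_pM2l.
apply: ler_sum => i _; rewrite submxcolB.
pose p := submxcol x i - xc i; pose q := submxcol z i - xc i.
have -> : submxcol x i - submxcol z i = p - q by rewrite opprB addrA subrK.
have qp : Q i p <= kap i ^+ 2.
  exact: barrier_radius (@convX i) (nu0 i) (barF i) (xcmin i) _ (Xx i).
have qq : Q i q <= kap i ^+ 2.
  exact: barrier_radius (@convX i) (nu0 i) (barF i) (xcmin i) _ (Xz i).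
have par : Q i (p + q) + Q i (p - q) = 2 * Q i p + 2 * Q i q.
  by apply: (barrier_hess_parallelogram (barF i)); case: (xcmin i).
move: qp qq par (Q_ge0 (p + q)); move: (Q i p) (Q i q) (Q i (p + q)) (Q i (p - q)).
by move: (kap i ^+ 2) => k a b c d; lra.
Qed.

End separable_barrier.

Theorem theorem2 (R : realType) (m N : nat) (n : 'I_N -> nat)
  (phi : forall i : 'I_N, 'cV[R]_(n i) -> R)
  (X : forall i : 'I_N, set 'cV[R]_(n i))
  (A : forall i : 'I_N, 'M[R]_(m, n i))
  (b : 'I_N -> 'cV[R]_m)
  (nu : 'I_N -> R)
  (F : forall i : 'I_N, 'cV[R]_(n i) -> R)
  (xc : forall i : 'I_N, 'cV[R]_(n i))
  (ystar : R -> 'cV[R]_m)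
  (t : R) (y v : nat -> 'cV[R]_m) (theta : nat -> R) :
  let A' := \mxrow_i A i in
  let b' := \sum_i b i in
  let X' := prod_set X in
  let phi' := sep_sum phi in
  let F' := sep_sum F in
  let feasible := [set x | A' *m x = b'] `&` X' in
  let g := smoothed_dual phi' F' X' A' b' in
  let gstar := smoothed_dual_value phi' F' X' A' b' in
  let cA := kappa nu * local_norm F' A' (\mxcol_i xc i) in
  (0 < m)%N -> (0 < N)%N ->
  (forall i, concave_function (phi i)) ->
  (forall i, [/\ X i !=set0, closed (X i)
     & convex_set (X i : set (convex_lmodType 'cV[R]_(n i)))]) ->
  is_argmax feasible phi' !=set0 ->
  polyhedral X' \/ relint X' `&` [set x | A' *m x = b'] !=set0 ->
  (forall i, proper_concave (fun x => (phi i x)%:E) /\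
     upper_semicontinuous (fun x => (phi i x)%:E)) ->
  row_free A' ->
  (forall i, bounded_set (X i)) ->
  (forall i, (X i)° !=set0) ->
  (forall i, 0 < nu i /\ self_concordant_barrier (X i) (nu i) (F i)) ->
  (forall i, is_argmin (X i)° (F i) (xc i) /\ F i (xc i) = 0) ->
  (forall s, 0 < s -> unique (is_argmin [set: 'cV[R]_m] (g s)) (ystar s)) ->
  0 < t ->
  fast_gradient_run (grad (g t)) t cA y v theta ->
  norm2 (grad (g t) (y 0%N)) <= 3 * cA / 4 ->
  forall k : nat,
    g t (y k) - gstar t <=
      4 * cA ^+ 2 / (t * (k.+1)%:R ^+ 2) * norm2 (y 0%N - ystar t) ^+ 2.
Proof.
move=> A' b' X' phi' F' feasible g gstar cA m0 N0 concphi HX [xh [[Axh Xxh] _]] _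
  uscphi freeA bndX _ barF xcmin yuniq t0 run _ k.
have convX i : convex_set (X i : set (convex_lmodType 'cV[R]_(n i))).
  by case: (HX i).
have clX i : closed (X i) by case: (HX i).
have nu0 i : 0 < nu i by case: (barF i).
have bar i : self_concordant_barrier (X i) (nu i) (F i) by case: (barF i).
have xcm i : is_argmin (X i)° (F i) (xc i) by case: (xcmin i).
pose xc' := \mxcol_i xc i.
have symH := separable_hessian_sym bar xcm.
have pdH := separable_hessian_gt0 bndX bar xcm.
have k0 : 0 < kappa nu by exact: kappa_gt0.
have cA0 : 0 < cA.
  by rewrite mulr_gt0//; exact: local_norm_gt0 symH pdH m0 freeA.
pose N2 := center_norm2 nu F xc.
have lip u : norm2 (A' *m u) ^+ 2 <= cA ^+ 2 * N2 u.
  have -> : cA ^+ 2 * N2 u = local_norm F' A' xc' ^+ 2 *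
      dotv u (hessian F' xc' *m u).
    by rewrite /cA /N2 /center_norm2; field; rewrite gt_eqF.
  exact: norm2_mulmx_local_norm symH pdH u.
(* The solution [xh] is used only as a feasible point, to write b' as A' xh. *)
have Ale x : X'° x -> norm2 (A' *m x - b') <= 2 * cA.
  move=> /interior_subset Xx; rewrite -Axh -mulmxBr.
  have cA2 : 0 <= 2 * cA by rewrite mulr_ge0// ltW.
  rewrite -ler_sqr ?nnegrE ?norm2_ge0//.
  apply: le_trans (lip _) _.
  have N4 : N2 (x - xh) <= 4 by apply: (center_norm2_diff N0 convX nu0 bar xcm).
  by have := ler_wpM2l (sqr_ge0 cA) N4; lra.
have int0 : X'° !=set0 by exists xc'; exact: center_interior xcm.
have seg := prod_set_segment convX.
have conc x z s : 0 <= s <= 1 ->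
    (1 - s) * phi' x + s * phi' z <= phi' (x + s *: (z - x)).
  move=> s01; rewrite /phi' /sep_sum !mulr_sumr -big_split/=.
  apply: ler_sum => i _; rewrite submxcol_line submxcolB.
  exact: concave_functionP.
have strong := separable_strongly_convex N0 convX nu0 bar xcm.
(* The normalization at [xc] makes the barrier nonnegative, so bounding each phi_i on X_i is
   enough. *)
have bnd : exists B, forall x, X'° x -> phi' x - t * F' x <= B.
  have /choice[B phiB] : forall i, exists B, forall x, X i x -> phi i x <= B.
    by move=> i; apply: usc_bounded_above; rewrite //; case: (uscphi i).
  exists (\sum_i B i) => x Xx.
  have F0 : 0 <= F' x.
    apply: sumr_ge0 => i _; case: (xcmin i) => [[_ Fmin] <-].
    by apply: Fmin; move/interior_prod_set: Xx.
  have : phi' x <= \sum_i B i.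
    by apply: ler_sum => i _; apply: phiB; exact: (interior_subset Xx).
  have := mulr_ge0 (ltW t0) F0; lra.
have gradE z := grad_smoothed_dual t0 cA0 int0 seg conc strong lip Ale bnd z.
have [ymin _] := yuniq t t0.
have -> : gstar t = g t (ystar t) by exact: inf_range_argmin ymin.
apply: (fast_gradient_rate t0 cA0 run) => [z w|z w|z|z].
- rewrite gradE.
  exact: (smoothed_dual_subgradient t0 cA0 int0 seg conc strong lip Ale bnd).
- rewrite gradE.
  exact: (smoothed_dual_upper t0 cA0 int0 seg conc strong lip Ale bnd).
- rewrite gradE.
  exact: (norm2_dual_gradient t0 cA0 int0 seg conc strong lip Ale bnd).
- by case: ymin => _; exact.
Qed.
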